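(* Let $k$ be a field of characteristic $p>0$ and let $H$ be a finite-dimensional pointed rank one Hopf algebra over $k$ which is generated as an algebra by $H_1$. If $H$ is of third type with skew point $a$, then $H$ is isomorphic (as a Hopf algebra) to a Hopf algebra $H_E$ for a tuple $E=(G(H),a,c,\alpha)$.
   Context: For a finite-dimensional Hopf algebra $H$ over $k$: $G(H)$ is the group of group-like elements; the coradical $H_0$ is the sum of the simple subcoalgebras; $H_1=\Delta^{-1}(H\otimes H_0+H_0\otimes H)$. $H$ is pointed if all simple subcoalgebras are one-dimensional, so that $H_0=kG(H)$. For $g,h\in G(H)$, $P_{g,h}=\{c\in H:\Delta(c)=c\otimes g+h\otimes c\}$. An element $a\in G(H)$ is a skew point if $P_{a,1}\setminus H_0\neq\emptyset$. A pointed $H$ has rank $t$ if $\dim_k k\otimes_{H_0}H_1=t+1$ ($k$ trivial via the counit). A pointed rank one Hopf algebra has exactly one skew point $a$, and it is central in $G(H)$. $H$ is of third type if $a\ne1$ and there is $x\in P_{a,1}\setminus H_0$ with $axa^{-1}=x+(a-1)$. Third type $H_E$. Let $E=(G,a,c,\alpha)$ where $G$ is a finite group, $a\in Z(G)$ has order divisible by $p$, $c:G\to(k,+)$ is a group homomorphism with $c(a)=1$, $\alpha\in k$, and, if $a^p\neq1$, $c(g)\in\mathbb{F}_p$ for all $g\in G$. $H_E$ is the algebra containing $kG$ and an element $x$, with basis $(gx^i)_{g\in G,\,0\le i\le p-1}$ and relations $gxg^{-1}=x+c(g)(a-1)$ ($g\in G$), $x^p=x+\alpha(a^p-1)$; its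 Hopf structure is $\Delta(gx^i)=(g\otimes g)(x\otimes a+1\otimes x)^i$, $\epsilon(gx^i)=\delta_{i,0}$, $S(gx^i)=(-xa^{-1})^ig^{-1}$. *)

(* Defs.v *)
From HB Require Import structures.
From mathcomp Require Import all_boot all_order all_fingroup all_algebra.
From mathcomp Require Import all_solvable all_field.
From mathcomp Require Import boolp.

Set Implicit Arguments.
Unset Strict Implicit.
Unset Printing Implicit Defensive.

Import GRing.Theory VectorInternalTheory.

Local Open Scope ring_scope.

(* A concrete tensor product: the (i, j) entry of a matrix is the coefficient *)
(* of e_i (x) e_j, for the coordinate bases of U and V.  It is only used      *)
(* through pure tensors and the universal property tensor_liftE/tensor_ext.   *)
Definition tensor (k : fieldType) (U V : vectType k) : Type :=
  'M[k]_(dim U, dim V).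

HB.instance Definition _ (k : fieldType) (U V : vectType k) :=
  Vector.copy (tensor U V) 'M[k]_(dim U, dim V).

Section Tensor.
Variable k : fieldType.
Implicit Types U V W : vectType k.

Definition pure U V (u : U) (v : V) : tensor U V := (v2r u)^T *m v2r v.

Definition coord_vec U (i : 'I_(dim U)) : U := r2v (delta_mx 0 i).

Definition tensor_lift U V W (f : U -> V -> W) (t : tensor U V) : W :=
  \sum_i \sum_j t i j *: f (coord_vec i) (coord_vec j).

Definition bilin U V W (f : U -> V -> W) : Prop :=
  (forall v, linear (f^~ v)) /\ (forall u, linear (f u)).

Lemma pure_bilin U V : bilin (@pure U V).
Proof.
split=> [v a u u'|u a v v']; rewrite /pure.
  by rewrite linearP linearP /= mulmxDl scalemxAl.
by rewrite linearP /= mulmxDr scalemxAr.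
Qed.

Lemma coord_vecE U (u : U) : u = \sum_i v2r u 0 i *: coord_vec i.
Proof.
rewrite -{1}[u]v2rK {1}[v2r u]row_sum_delta linear_sum.
by apply: eq_bigr => i _; rewrite linearZ.
Qed.

Lemma tensor_lift_linear U V W (f : U -> V -> W) : linear (tensor_lift f).
Proof.
move=> a t t'; rewrite /tensor_lift scaler_sumr -big_split; apply: eq_bigr => i _.
rewrite scaler_sumr -big_split; apply: eq_bigr => j _ /=.
by rewrite !mxE scalerDl scalerA.
Qed.

HB.instance Definition _ U V W (f : U -> V -> W) :=
  GRing.isLinear.Build k (tensor U V) W _ (tensor_lift f) (tensor_lift_linear f).

Lemma bilin_suml U V W (f : U -> V -> W) n (a : 'I_n -> k) (x : 'I_n -> U) v :
  bilin f -> f (\sum_i a i *: x i) v = \sum_i a i *: f (x i) v.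
Proof.
case=> lf _; pose g := f^~ v.
pose G : {linear U -> W} := HB.pack g (GRing.isLinear.Build k U W _ g (lf v)).
have -> : f (\sum_i a i *: x i) v = G (\sum_i a i *: x i) by [].
by rewrite linear_sum; apply: eq_bigr => i _; rewrite linearZ.
Qed.

Lemma bilin_sumr U V W (f : U -> V -> W) n (a : 'I_n -> k) (x : 'I_n -> V) u :
  bilin f -> f u (\sum_i a i *: x i) = \sum_i a i *: f u (x i).
Proof.
by case=> lf lf'; apply: (@bilin_suml V U W (fun v u => f u v)).
Qed.

Lemma tensor_liftE U V W (f : U -> V -> W) u v :
  bilin f -> tensor_lift f (pure u v) = f u v.
Proof.
move=> bf; rewrite [in RHS](coord_vecE u) [in RHS](coord_vecE v).
rewrite bilin_suml //; apply: eq_bigr => i _.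
rewrite bilin_sumr // scaler_sumr; apply: eq_bigr => j _.
by rewrite /pure !mxE big_ord1 mxE scalerA.
Qed.

Lemma tensorE U V (t : tensor U V) :
  t = \sum_i \sum_j t i j *: pure (coord_vec i) (coord_vec j).
Proof.
rewrite {1}[t]matrix_sum_delta; apply: eq_bigr => i _; apply: eq_bigr => j _.
congr (_ *: _); rewrite /pure !r2vK; apply/matrixP=> i' j'.
by rewrite !mxE big_ord1 !mxE eqxx /= -natrM mulnb.
Qed.

Lemma tensor_ext U V W (f g : tensor U V -> W) : linear f -> linear g ->
  (forall u v, f (pure u v) = g (pure u v)) -> f =1 g.
Proof.
move=> lf lg fg t.
pose F : {linear tensor U V -> W} :=
  HB.pack f (GRing.isLinear.Build k (tensor U V) W _ f lf).
pose G : {linear tensor U V -> W} :=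
  HB.pack g (GRing.isLinear.Build k (tensor U V) W _ g lg).
rewrite -[f]/(F : _ -> _) -[g]/(G : _ -> _) (tensorE t) !linear_sum.
apply: eq_bigr => i _; rewrite !linear_sum; apply: eq_bigr => j _.
by rewrite !linearZ /= fg.
Qed.

Lemma tensor_lift_eq U V W (f g : U -> V -> W) t :
  (forall u v, f u v = g u v) -> tensor_lift f t = tensor_lift g t.
Proof. by move=> fg; apply: eq_bigr => i _; apply: eq_bigr => j _; rewrite fg. Qed.

Definition tensor_map U V U' V' (f : U -> U') (g : V -> V') :
  tensor U V -> tensor U' V' := tensor_lift (fun u v => pure (f u) (g v)).

Definition tensor_assoc U V W :
    tensor (tensor U V) W -> tensor U (tensor V W) :=
  tensor_lift (fun t w => tensor_lift (fun u v => pure u (pure v w)) t).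

End Tensor.

Notation "u ⊗ v" := (pure u v) (at level 40, left associativity) : ring_scope.

Section TensorAlgebra.
Variable k : fieldType.
Implicit Types A B : falgType k.

Definition tensor_mul A B (s t : tensor A B) : tensor A B :=
  tensor_lift (fun a b => tensor_lift (fun a' b' => (a * a') ⊗ (b * b')) t) s.

Lemma bilin_pure_mul A B (a : A) (b : B) :
  bilin (fun (a' : A) (b' : B) => (a * a') ⊗ (b * b')).
Proof.
have [pl pr] := pure_bilin A B.
split=> [v c x y|u c x y] /=; rewrite mulrDr -scalerAr; [exact: pl|exact: pr].
Qed.

Lemma bilin_tensor_mul A B (t : tensor A B) :
  bilin (fun (a : A) (b : B) =>
           tensor_lift (fun a' b' => (a * a') ⊗ (b * b')) t).
Proof.
have [pl pr] := pure_bilin A B.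
split=> [v c x y|u c x y] /=; rewrite /tensor_lift scaler_sumr -big_split;
  apply: eq_bigr => i _; rewrite scaler_sumr -big_split; apply: eq_bigr => j _ /=;
  rewrite mulrDl -scalerAl (pl, pr) scalerDr !scalerA mulrC.
  by [].
by [].
Qed.

Lemma tensor_mulE A B (a a' : A) (b b' : B) :
  tensor_mul (a ⊗ b) (a' ⊗ b') = (a * a') ⊗ (b * b').
Proof.
rewrite /tensor_mul tensor_liftE; last exact: bilin_tensor_mul.
by rewrite tensor_liftE //; apply: bilin_pure_mul.
Qed.

Lemma tensor_mul_linl A B (t : tensor A B) : linear (fun s => tensor_mul s t).
Proof. exact: tensor_lift_linear. Qed.

Lemma tensor_mul_linr A B (s : tensor A B) : linear (tensor_mul s).
Proof.
move=> c t t'.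
have E x : tensor_mul s x = \sum_i \sum_j s i j *: tensor_lift
  (fun a' b' => (coord_vec i * a') ⊗ (coord_vec j * b')) x by [].
rewrite !E scaler_sumr -big_split; apply: eq_bigr => i _.
rewrite scaler_sumr -big_split; apply: eq_bigr => j _ /=.
by rewrite linearP scalerDr !scalerA [_ * c]mulrC.
Qed.

Lemma tensor_mulA A B : associative (@tensor_mul A B).
Proof.
move=> r s t; move: r; apply: tensor_ext => [||a b].
- exact: tensor_mul_linl.
- by move=> c x y; rewrite !tensor_mul_linl.
move: s; apply: tensor_ext => [||a' b'].
- by move=> c x y; rewrite tensor_mul_linl tensor_mul_linr.
- by move=> c x y; rewrite tensor_mul_linr tensor_mul_linl.
move: t; apply: tensor_ext => [||a'' b''].
- by move=> c x y; rewrite !tensor_mul_linr.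
- exact: tensor_mul_linr.
by rewrite !tensor_mulE !mulrA.
Qed.

Lemma tensor_mul1 A B : left_id (1 ⊗ 1) (@tensor_mul A B).
Proof.
apply: tensor_ext => [||a b]; [exact: tensor_mul_linr | by [] |].
by rewrite tensor_mulE !mul1r.
Qed.

Lemma tensor_1mul A B : right_id (1 ⊗ 1) (@tensor_mul A B).
Proof.
apply: tensor_ext => [||a b]; [exact: tensor_mul_linl | by [] |].
by rewrite tensor_mulE !mulr1.
Qed.

Lemma tensor_mulDl A B : left_distributive (@tensor_mul A B) +%R.
Proof. by move=> s s' t; have := tensor_mul_linl t 1 s s'; rewrite !scale1r. Qed.

Lemma tensor_mulDr A B : right_distributive (@tensor_mul A B) +%R.
Proof. by move=> s t t'; have := tensor_mul_linr s 1 t t'; rewrite !scale1r. Qed.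

Lemma pure_eq0 (U V : vectType k) (u : U) (v : V) :
  (u ⊗ v == 0) = (u == 0) || (v == 0).
Proof.
apply/idP/idP => [/eqP uv0|]; last first.
  have [pl pr] := pure_bilin U V.
  case/orP => /eqP->.
    by have := pl v (-1) 0 0; rewrite scaler0 addr0 scaleN1r addNr => ->.
  by have := pr u (-1) 0 0; rewrite scaler0 addr0 scaleN1r addNr => ->.
rewrite -implyNb; apply/implyP => u0; apply/eqP.
have /existsP[i ui] : [exists i, v2r u 0 i != 0].
  apply: contraNT u0; rewrite negb_exists => /forallP u0.
  rewrite -[u]v2rK; apply/eqP; rewrite -[RHS]v2rK linear0; congr r2v.
  by apply/rowP => i; rewrite mxE; apply/eqP; rewrite -[_ == _]negbK.
apply: v2r_inj; rewrite linear0; apply/rowP => j; rewrite [RHS]mxE.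
have /matrixP/(_ i j) := uv0; rewrite !mxE big_ord1 mxE => /eqP.
by rewrite mulf_eq0 (negPf ui) => /eqP.
Qed.

Lemma tensor_1neq0 A B : (1 : A) ⊗ (1 : B) != 0.
Proof. by rewrite pure_eq0 !oner_eq0. Qed.

HB.instance Definition _ A B := GRing.Zmodule_isNzRing.Build (tensor A B)
  (@tensor_mulA A B) (@tensor_mul1 A B) (@tensor_1mul A B)
  (@tensor_mulDl A B) (@tensor_mulDr A B) (@tensor_1neq0 A B).

Lemma tensor_scalerAl A B (c : k) (s t : tensor A B) : c *: (s * t) = c *: s * t.
Proof.
have := tensor_mul_linl t c s 0; rewrite addr0 /= => h; rewrite [RHS]h.
have := tensor_mul_linl t (-1) 0 0.
by rewrite scaler0 addr0 /= scaleN1r addNr => ->; rewrite addr0.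
Qed.

Lemma tensor_scalerAr A B (c : k) (s t : tensor A B) : c *: (s * t) = s * (c *: t).
Proof.
have := tensor_mul_linr s c t 0; rewrite addr0 => h; rewrite [RHS]h.
have := tensor_mul_linr s (-1) 0 0.
by rewrite scaler0 addr0 scaleN1r addNr => ->; rewrite addr0.
Qed.

HB.instance Definition _ A B :=
  GRing.Lmodule_isLalgebra.Build k (tensor A B) (@tensor_scalerAl A B).
HB.instance Definition _ A B :=
  GRing.Lalgebra_isAlgebra.Build k (tensor A B) (@tensor_scalerAr A B).
HB.instance Definition _ A B := Algebra_isFalgebra.Build k (tensor A B).

Lemma pureM A B (a a' : A) (b b' : B) : (a ⊗ b) * (a' ⊗ b') = (a * a') ⊗ (b * b').
Proof. exact: tensor_mulE. Qed.

End TensorAlgebra.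

HB.mixin Record isHopfAlgebra (k : fieldType) H of Falgebra k H := {
  comul : {lrmorphism H -> tensor H H};
  counit : {lrmorphism H -> k^o};
  antipode : {linear H -> H};
  comulA : forall h, tensor_assoc (tensor_map comul id (comul h))
                   = tensor_map id comul (comul h);
  counitl : forall h, tensor_lift (fun u v => counit u *: v) (comul h) = h;
  counitr : forall h, tensor_lift (fun u v => counit v *: u) (comul h) = h;
  antipodel : forall h,
    tensor_lift (fun u v => antipode u * v) (comul h) = (counit h)%:A;
  antipoder : forall h,
    tensor_lift (fun u v => u * antipode v) (comul h) = (counit h)%:A
}.

#[short(type="hopfAlgType")]
HB.structure Definition HopfAlgebra (k : fieldType) :=
  { H of isHopfAlgebra k H & Falgebra k H }.

Definition hopf_iso (k : fieldType) (A B : hopfAlgType k) : Prop :=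
  exists f : {lrmorphism A -> B},
    [/\ bijective f,
        forall u, comul (f u) = tensor_map f f (comul u),
        forall u, counit (f u) = counit u
      & forall u, antipode (f u) = f (antipode u)].

Section Span.
Variables (k : fieldType) (V : vectType k).

Lemma cspan_ex (S : V -> Prop) : exists W : {vspace V},
  (forall v, S v -> v \in W) /\
  (forall U : {vspace V}, (forall v, S v -> v \in U) -> (W <= U)%VS).
Proof.
pose P n := `[< exists2 W : {vspace V}, forall v, S v -> v \in W & \dim W = n >].
have exP : exists n, P n.
  by exists (\dim {:V}); apply/asboolP; exists fullv => // v _; apply: memvf.
case: (ex_minnP exP) => n /asboolP[W SW dW] minn; exists W; split=> // U SU.
have SWU v : S v -> v \in (W :&: U)%VS by move=> Sv; rewrite memv_cap SW ?SU.
have /minn dWU : P (\dim (W :&: U)%VS) by apply/asboolP; exists (W :&: U)%VS.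
have /eqP <- : (W :&: U)%VS == W by rewrite eqEdim capvSl dW.
exact: capvSr.
Qed.

(* The linear span of an arbitrary, possibly infinite, set of vectors. *)
Definition cspan (S : V -> Prop) : {vspace V} := projT1 (cid (cspan_ex S)).

Lemma mem_cspan (S : V -> Prop) v : S v -> v \in cspan S.
Proof. by rewrite /cspan; case: (cid _) => W /= [SW _]; apply: SW. Qed.

Lemma cspan_sub (S : V -> Prop) (U : {vspace V}) :
  (forall v, S v -> v \in U) -> (cspan S <= U)%VS.
Proof. by rewrite /cspan; case: (cid _) => W /= [_ minW]; apply: minW. Qed.

End Span.

Definition tensorv (k : fieldType) (U V : vectType k)
    (X : {vspace U}) (Y : {vspace V}) : {vspace tensor U V} :=
  cspan (fun t => exists u v, [/\ u \in X, v \in Y & t = u ⊗ v]).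

Section Coalgebra.
Variables (k : fieldType) (H : hopfAlgType k).

Definition subcoalgebra (C : {vspace H}) : Prop :=
  forall h, h \in C -> comul h \in tensorv C C.

Definition simple_subcoalgebra (C : {vspace H}) : Prop :=
  [/\ subcoalgebra C, C != 0%VS
    & forall D, subcoalgebra D -> (D <= C)%VS -> D = 0%VS \/ D = C].

Definition coradical : {vspace H} :=
  cspan (fun h => exists2 C, simple_subcoalgebra C & h \in C).

Definition coradical1 : {vspace H} :=
  (linfun comul @^-1:
     (tensorv {:H} coradical + tensorv coradical {:H}))%VS.

Definition pointed : Prop :=
  forall C, simple_subcoalgebra C -> \dim C = 1%N.

(* The quotient of k (x) N by these relations is k (x)_A N, where k is the    *)
(* trivial right A-module and A acts on N by left multiplication.             *)
Definition balancing_relations (A N : {vspace H}) : {vspace tensor k^o H} :=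
  cspan (fun t => exists (l : k^o) (b n : H),
    [/\ b \in A, n \in N & t = (l * counit b) ⊗ n - l ⊗ (b * n)]).

Definition dim_trivial_tensor (A N : {vspace H}) : nat :=
  (\dim (tensorv {:k^o} N) - \dim (balancing_relations A N))%N.

Definition has_rank (t : nat) : Prop :=
  dim_trivial_tensor coradical coradical1 = t.+1.

Definition is_grouplike (g : H) : bool := (comul g == g ⊗ g) && (g != 0).

End Coalgebra.

Arguments coradical {k} H.
Arguments coradical1 {k} H.
Arguments pointed {k} H.
Arguments has_rank {k} H t.

Section GroupLike.
Variables (k : fieldType) (H : hopfAlgType k).

Record grouplike : Type := Grouplike {
  glval :> H;
  glvalP : is_grouplike glval
}.

HB.instance Definition _ := [isSub for glval].
HB.instance Definition _ := [Choice of grouplike by <:].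

Implicit Types g h : grouplike.

Lemma gl_comul g : comul (g : H) = (g : H) ⊗ (g : H).
Proof. by case/andP: (glvalP g) => /eqP. Qed.

Lemma gl_neq0 g : (g : H) != 0.
Proof. by case/andP: (glvalP g). Qed.

Lemma bilin_comp (U V U' V' W : vectType k) (f : {linear U' -> U})
    (g : {linear V' -> V}) (B : U -> V -> W) :
  bilin B -> bilin (fun u v => B (f u) (g v)).
Proof.
by case=> Bl Br; split=> [v c x y|u c x y] /=; rewrite linearP ?(Bl, Br).
Qed.

Lemma bilin_scale (V : vectType k) : bilin (fun (a : k^o) (v : V) => a *: v).
Proof.
split=> [v c x y|u c x y] /=; first by rewrite scalerDl scalerA.
by rewrite scalerDr !scalerA mulrC.
Qed.

Lemma bilin_mul (A : falgType k) : bilin (fun u v : A => u * v).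
Proof.
by split=> [v c x y|u c x y] /=; [rewrite mulrDl scalerAl|rewrite mulrDr scalerAr].
Qed.

Lemma gl_counit g : counit (g : H) = 1.
Proof.
have := counitl (g : H); rewrite gl_comul.
rewrite (tensor_liftE _ _ (bilin_comp (@counit k H) idfun (@bilin_scale H))) /=.
move/eqP; rewrite -subr_eq0 -[X in _ - X]scale1r -scalerBl scaler_eq0.
by rewrite (negPf (gl_neq0 g)) orbF subr_eq0 => /eqP.
Qed.

Lemma gl_unit g : (g : H) \is a GRing.unit.
Proof.
apply/unitrP; exists (antipode (g : H)); split.
  have := antipodel (g : H); rewrite gl_comul gl_counit scale1r.
  by rewrite (tensor_liftE _ _ (bilin_comp (@antipode k H) idfun (@bilin_mul H))).
have := antipoder (g : H); rewrite gl_comul gl_counit scale1r.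
by rewrite (tensor_liftE _ _ (bilin_comp idfun (@antipode k H) (@bilin_mul H))).
Qed.

Lemma gl_free (s : seq grouplike) : uniq s -> free [seq (g : H) | g <- s].
Proof.
elim: s => [|g s IHs] /=; first by rewrite nil_free.
case/andP=> gs /IHs frs; rewrite free_cons frs andbT.
apply: contra gs; set X := in_tuple [seq (g : H) | g <- s].
move=> gX; have := coord_span (gX : (g : H) \in <<X>>%VS) => gE.
have /existsP[i ci] : [exists i, coord X i (glval g) != 0].
  apply: contraNT (gl_neq0 g); rewrite negb_exists => /forallP c0.
  rewrite gE big1 // => i _; have := c0 i; rewrite negbK => /eqP->.
  exact: scale0r.
have lt_is : (i < size s)%N by have := ltn_ord i; rewrite {2}size_map.
have Xi (j : 'I_(size X)) : exists2 h : grouplike, h \in s & X`_j = h :> H.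
  have lt_js : (j < size s)%N by have := ltn_ord j; rewrite {2}size_map.
  by exists (nth g s j); [apply: mem_nth | rewrite (nth_map g)].
pose B (u v : H) : H := coord X i u *: v.
have bB : bilin B by exact: (bilin_comp (coord X i : {linear H -> k^o}) idfun (@bilin_scale H)).
have E1 : tensor_lift B (comul (g : H)) = coord X i (glval g) *: (g : H).
  by rewrite gl_comul tensor_liftE.
have E2 : tensor_lift B (comul (g : H)) = coord X i (glval g) *: X`_i.
  rewrite {1}gE !linear_sum (bigD1 i) //= big1 ?addr0 => [|j ji].
    have [h _ hE] := Xi i; rewrite !linearZ /= hE gl_comul tensor_liftE //.
    by rewrite -hE /B coord_free // eqxx scale1r.
  have [h _ hE] := Xi j; rewrite !linearZ /= hE gl_comul tensor_liftE //.
  by rewrite -hE /B coord_free // (negPf ji) scale0r scaler0.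
have gXi : (g : H) = X`_i by apply: (scalerI ci); rewrite -E1 -E2.
by have [h hs hE] := Xi i; have /val_inj-> : \val g = \val h by rewrite /= gXi.
Qed.

Lemma gl_enum_ex : exists s : seq grouplike, uniq s /\ forall g, g \in s.
Proof.
pose P n := `[< exists2 s : seq grouplike, uniq s & size s = n >].
have exP : exists n, P n by exists 0%N; apply/asboolP; exists [::].
have leP n : P n -> (n <= \dim {:H})%N.
  move/asboolP=> [s us <-]; have := gl_free us; rewrite /free size_map => /eqP <-.
  exact: dimvS (subvf _).
case: (ex_maxnP exP leP) => n /asboolP[s us sn] maxs; exists s; split=> // g.
apply/negPn/negP => gs; have /maxs : P n.+1.
  by apply/asboolP; exists (g :: s); rewrite /= ?gs ?us ?sn.
by rewrite ltnn.
Qed.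

Definition gl_enum : seq grouplike := projT1 (cid gl_enum_ex).

Lemma gl_enum_uniq : uniq gl_enum.
Proof. by rewrite /gl_enum; case: (cid _) => s []. Qed.

Lemma mem_gl_enum g : g \in gl_enum.
Proof. by rewrite /gl_enum; case: (cid _) => s []. Qed.

Lemma gl_enumP : Finite.axiom gl_enum.
Proof. by move=> g; rewrite count_uniq_mem ?gl_enum_uniq ?mem_gl_enum. Qed.

Lemma gl_pickleK :
  pcancel (index^~ gl_enum) (fun n => nth None [seq Some g | g <- gl_enum] n).
Proof.
by move=> g; rewrite (nth_map g) ?nth_index ?index_mem ?mem_gl_enum.
Qed.

HB.instance Definition _ : isCountable grouplike := PCanIsCountable gl_pickleK.
HB.instance Definition _ := isFinite.Build grouplike gl_enumP.

Lemma gl1_subproof : is_grouplike (1 : H).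
Proof. by rewrite /is_grouplike rmorph1 eqxx oner_eq0. Qed.

Lemma glM_subproof g h : is_grouplike ((g : H) * (h : H)).
Proof.
rewrite /is_grouplike rmorphM /= !gl_comul pureM eqxx /=.
by apply: contra (gl_neq0 h) => /eqP gh0; rewrite -(mulKr (gl_unit g) (h : H)) gh0 mulr0.
Qed.

Lemma glV_subproof g : is_grouplike ((g : H)^-1).
Proof.
have gu := gl_unit g; rewrite /is_grouplike invr_eq0 gl_neq0 andbT.
rewrite rmorphV //= gl_comul; apply/eqP.
have ggV : ((g : H) ⊗ (g : H)) * ((g : H)^-1 ⊗ (g : H)^-1) = 1.
  by rewrite pureM mulrV.
have ggu : (g : H) ⊗ (g : H) \is a GRing.unit.
  by rewrite -gl_comul; apply: rmorph_unit.
by rewrite -[LHS]mulr1 -ggV mulKr.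
Qed.

Definition gl1 : grouplike := Grouplike gl1_subproof.
Definition glM g h : grouplike := Grouplike (glM_subproof g h).
Definition glV g : grouplike := Grouplike (glV_subproof g).

Lemma glMA : associative glM.
Proof. by move=> g h l; apply: val_inj; rewrite /= mulrA. Qed.
Lemma gl1M : left_id gl1 glM.
Proof. by move=> g; apply: val_inj; rewrite /= mul1r. Qed.
Lemma glVM : left_inverse gl1 glV glM.
Proof. by move=> g; apply: val_inj; rewrite /= mulVr ?gl_unit. Qed.

HB.instance Definition _ := Finite_isGroup.Build grouplike glMA gl1M glVM.

Definition skew_primitive g h (c : H) : Prop :=
  comul c = c ⊗ (g : H) + (h : H) ⊗ c.

Definition skew_point (a : grouplike) : Prop :=
  exists2 c, skew_primitive a 1%g c & c \notin coradical H.

Definition third_type (a : grouplike) : Prop :=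
  a != 1%g /\
  exists x : H, [/\ skew_primitive a 1%g x, x \notin coradical H
    & (a : H) * x * (a : H)^-1 = x + ((a : H) - 1)].

End GroupLike.

Record third_type_tuple (k : fieldType) (p : nat) (G : finGroupType) :=
  ThirdTypeTuple {
    tt_a : G;
    tt_c : G -> k;
    tt_alpha : k;
    tt_center : (tt_a \in 'Z([set: G]))%g;
    tt_order : (p %| #[tt_a]%g)%N;
    tt_morph : forall g h, tt_c (g * h)%g = tt_c g + tt_c h;
    tt_c_a : tt_c tt_a = 1;
    tt_Fp : (tt_a ^+ p != 1)%g -> forall g, exists n : nat, tt_c g = n%:R
  }.

(* A is the Hopf algebra H_E, with j the inclusion of G in A; these           *)
(* conditions determine A up to isomorphism of Hopf algebras, see is_HE_iso.  *)
Record is_HE (k : fieldType) (p : nat) (G : finGroupType)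
    (E : third_type_tuple k p G)
    (A : hopfAlgType k) (j : G -> A) (x : A) : Prop := IsHE {
  HE_one : j 1%g = 1;
  HE_mul : forall g h, j (g * h)%g = j g * j h;
  HE_basis : basis_of {:A} [seq j g * x ^+ val i | g <- enum G, i <- enum 'I_p];
  HE_conj : forall g, j g * x * j g^-1%g = x + tt_c E g *: (j (tt_a E) - 1);
  HE_pow : x ^+ p = x + tt_alpha E *: (j (tt_a E) ^+ p - 1);
  HE_comul : forall g (i : 'I_p),
    comul (j g * x ^+ i) = (j g ⊗ j g) * (x ⊗ j (tt_a E) + 1 ⊗ x) ^+ i;
  HE_counit : forall g (i : 'I_p), counit (j g * x ^+ i) = (val i == 0%N)%:R;
  HE_antipode : forall g (i : 'I_p),
    antipode (j g * x ^+ i) = (- (x * j (tt_a E)^-1%g)) ^+ i * j g^-1%g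
}.

Section HEUniqueness.
Variables (k : fieldType) (p : nat) (G : finGroupType).
Variable E : third_type_tuple k p G.

Section Realization.
Variables (A : hopfAlgType k) (j : G -> A) (x : A).
Hypothesis hA : is_HE E j x.
Let a := tt_a E.
Let c := tt_c E.
Let al := tt_alpha E.

Lemma HE_x_left g (i : nat) :
  x * (j g * x ^+ i) =
  j g * x ^+ i.+1 - c g *: (j (g * a)%g * x ^+ i - j g * x ^+ i).
Proof.
have jgV : j g^-1%g * j g = 1 by rewrite -(HE_mul hA) mulVg (HE_one hA).
have jga : j (g * a)%g = j a * j g.
  by rewrite -(HE_mul hA) (centerC (in_setT g) (tt_center E)).
have gx : j g * x = x * j g + c g *: (j (g * a)%g - j g).
  rewrite -[LHS]mulr1 -jgV mulrA (HE_conj hA) mulrDl -scalerAl mulrBl mul1r.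
  by rewrite jga.
rewrite exprS mulrA [in X in _ = X - _]mulrA gx mulrDl -scalerAl mulrBl.
by rewrite addrK.
Qed.

Lemma HE_xp g : (0 < p)%N ->
  j g * x ^+ p = j g * x + al *: (j (g * a ^+ p)%g - j g).
Proof.
have jX n : j (a ^+ n)%g = j a ^+ n.
  elim: n => [|n IHn]; first by rewrite expg0 (HE_one hA).
  by rewrite expgS (HE_mul hA) IHn exprS.
move=> p0; rewrite (HE_pow hA) mulrDr -scalerAr mulrBr mulr1 -jX -(HE_mul hA).
by [].
Qed.

End Realization.

Lemma basis_ext (U W : vectType k) (X : seq U) (f g : {linear U -> W}) :
  basis_of {:U} X -> {in X, f =1 g} -> f =1 g.
Proof.
move=> bX fg u; rewrite (coord_basis (bX : basis_of _ (in_tuple X)) (memvf u)).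
rewrite !linear_sum; apply: eq_bigr => i _; rewrite !linearZ; congr (_ *: _).
exact/fg/mem_nth.
Qed.

Section BasisMap.
Variables (A B : hopfAlgType k) (j : G -> A) (x : A) (j' : G -> B) (x' : B).
Hypothesis hA : is_HE E j x.

Lemma HE_map_ex : exists f : {linear A -> B},
  forall g (i : nat), (i < p)%N -> f (j g * x ^+ i) = j' g * x' ^+ i.
Proof.
pose s := [seq (g, i) | g <- enum G, i <- enum 'I_p].
pose m (gi : G * 'I_p) := j gi.1 * x ^+ gi.2.
pose m' (gi : G * 'I_p) := j' gi.1 * x' ^+ gi.2.
have sE : [seq j g * x ^+ val i | g <- enum G, i <- enum 'I_p] = map m s.
  by rewrite /s map_allpairs.
have bX : basis_of {:A} (in_tuple (map m s)) by rewrite /= -sE (HE_basis hA).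
pose f (u : A) : B :=
  \sum_(i < size (map m s)) coord (in_tuple (map m s)) i u *: (map m' s)`_i.
have lf : linear f.
  move=> b u v; rewrite /f scaler_sumr -big_split; apply: eq_bigr => i _.
  by rewrite linearP scalerDl scalerA.
pose F : {linear A -> B} := HB.pack f (GRing.isLinear.Build k A B _ f lf).
exists F => g i ip; rewrite -[LHS]/(f _).
have gs : (g, Ordinal ip) \in s by apply/allpairsP; exists (g, Ordinal ip); rewrite !mem_enum.
have lt_n : (index (g, Ordinal ip) s < size (map m s))%N by rewrite size_map index_mem.
have -> : j g * x ^+ i = (in_tuple (map m s))`_(Ordinal lt_n).
  by rewrite /= (nth_map (g, Ordinal ip)) ?index_mem // nth_index.
rewrite /f (bigD1 (Ordinal lt_n)) // big1 => [|n nn]; last first.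
  by rewrite coord_free ?(basis_free bX) // eq_sym (negPf nn) scale0r.
rewrite (coord_free (Ordinal lt_n) (Ordinal lt_n)) ?(basis_free bX) //.
rewrite eqxx scale1r /= addr0.
by rewrite (nth_map (g, Ordinal ip)) ?index_mem // nth_index.
Qed.


End BasisMap.

Variables (A B : hopfAlgType k) (j : G -> A) (x : A) (j' : G -> B) (x' : B).
Hypotheses (hA : is_HE E j x) (hB : is_HE E j' x').
Hypothesis p_gt1 : (1 < p)%N.

Lemma is_HE_iso_of (f : {linear A -> B}) :
    (forall g (i : nat), (i < p)%N -> f (j g * x ^+ i) = j' g * x' ^+ i) ->
    {morph f : u v / u * v} -> f 1 = 1 -> hopf_iso A B.
Proof.
move=> fE fM f1; have p_gt0 : (0 < p)%N by apply: ltnW.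
have f0 h : f (j h) = j' h by have := fE h 0%N p_gt0; rewrite !expr0 !mulr1.
have fx : f x = x'.
  have := fE 1%g 1%N p_gt1.
  by rewrite (HE_one hA) (HE_one hB) !mul1r.
have fXn n u : f (u ^+ n) = f u ^+ n.
  by elim: n => [|n IHn]; rewrite ?expr0 ?exprS ?fM ?IHn.
pose mf : GRing.isMonoidMorphism A B f := GRing.isMonoidMorphism.Build A B f (f1, fM).
pose F : {lrmorphism A -> B} := HB.pack (f : A -> B) (GRing.Linear.class f) mf.
have ff_bil : bilin (fun u v : A => (f u) ⊗ (f v)).
  by apply: bilin_comp; apply: pure_bilin.
have ffP u v : tensor_map f f (u ⊗ v) = f u ⊗ f v by rewrite /tensor_map tensor_liftE.
have ffD s t : tensor_map f f (s + t) = tensor_map f f s + tensor_map f f t.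
  by rewrite /tensor_map linearD.
have ffM s t : tensor_map f f (s * t) = tensor_map f f s * tensor_map f f t.
  move: s; apply: tensor_ext => [b u v|b u v|u v].
  - by rewrite mulrDl -scalerAl /tensor_map linearP.
  - by rewrite /tensor_map linearP mulrDl -scalerAl.
  move: t; apply: tensor_ext => [b s t|b s t|s t].
  - by rewrite mulrDr -scalerAr /tensor_map linearP.
  - by rewrite /tensor_map linearP mulrDr -scalerAr.
  by rewrite pureM !ffP !fM pureM.
have ffX n s : tensor_map f f (s ^+ n) = tensor_map f f s ^+ n.
  elim: n => [|n IHn]; last by rewrite !exprS ffM IHn.
  by rewrite !expr0 ffP f1.
exists F; split.
- have [g gE] := HE_map_ex j x hB.
  exists g => u.
    pose F1 : {linear A -> A} := g \o f.
    rewrite -[LHS]/(F1 u) -[RHS]/((idfun : {linear A -> A}) u).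
    apply: basis_ext (HE_basis hA) _ u => _ /allpairsP[[h i] [_ _ ->]] /=.
    by rewrite fE // gE.
  pose F1 : {linear B -> B} := f \o g.
  rewrite -[LHS]/(F1 u) -[RHS]/((idfun : {linear B -> B}) u).
  apply: basis_ext (HE_basis hB) _ u => _ /allpairsP[[h i] [_ _ ->]] /=.
  by rewrite gE // fE.
- move=> u; pose F1 : {linear A -> tensor B B} := comul \o f.
  pose F2 : {linear A -> tensor B B} :=
    tensor_lift (fun u v : A => f u ⊗ f v) \o comul.
  rewrite -[LHS]/(F1 u) -[RHS]/(F2 u); apply: basis_ext (HE_basis hA) _ u.
  move=> _ /allpairsP[[g i] [_ _ ->]] /=.
  rewrite fE // (HE_comul hB) (HE_comul hA) -[RHS]/(tensor_map f f _).
  by rewrite ffM ffP ffX ffD !ffP f1 fx !f0.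
- move=> u; pose F1 : {linear A -> k^o} := counit \o f.
  rewrite -[LHS]/(F1 u); apply: basis_ext (HE_basis hA) _ u.
  move=> _ /allpairsP[[g i] [_ _ ->]] /=.
  by rewrite fE // (HE_counit hB) (HE_counit hA).
move=> u; pose F1 : {linear A -> B} := antipode \o f.
pose F2 : {linear A -> B} := f \o antipode.
rewrite -[LHS]/(F1 u) -[RHS]/(F2 u); apply: basis_ext (HE_basis hA) _ u.
move=> _ /allpairsP[[g i] [_ _ ->]] /=.
rewrite fE // (HE_antipode hB) (HE_antipode hA) fM fXn linearN /= fM fx !f0.
by [].
Qed.

Lemma is_HE_iso : hopf_iso A B.
Proof.
have p_gt0 : (0 < p)%N by apply: ltnW.
have [f fE] := HE_map_ex j' x' hA.
have fa g (i : nat) : (i <= p)%N -> f (j g * x ^+ i) = j' g * x' ^+ i.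
  rewrite leq_eqVlt => /orP[/eqP->|]; last exact: fE.
  rewrite (HE_xp hA) // (HE_xp hB) // linearD linearZ linearB /=.
  have f0 h : f (j h) = j' h by have := fE h 0%N p_gt0; rewrite !expr0 !mulr1.
  by rewrite !f0 (fE g 1%N).
have fx u : f (x * u) = x' * f u.
  pose F1 : {linear A -> B} := f \o (x \*o idfun).
  pose F2 : {linear A -> B} := (x' \*o idfun) \o f.
  rewrite -[LHS]/(F1 u) -[RHS]/(F2 u); apply: basis_ext (HE_basis hA) _ u.
  move=> _ /allpairsP[[g i] [_ _ ->]] /=.
  rewrite (HE_x_left hA) linearB linearZ linearB /= !fa ?(ltnW (ltn_ord i)) //.
  by rewrite (HE_x_left hB).
have fj h u : f (j h * u) = j' h * f u.
  pose F1 : {linear A -> B} := f \o (j h \*o idfun).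
  pose F2 : {linear A -> B} := (j' h \*o idfun) \o f.
  rewrite -[LHS]/(F1 u) -[RHS]/(F2 u); apply: basis_ext (HE_basis hA) _ u.
  move=> _ /allpairsP[[g i] [_ _ ->]] /=.
  rewrite mulrA -(HE_mul hA) !fa ?(ltnW (ltn_ord i)) //.
  by rewrite (HE_mul hB) mulrA.
have fM u v : f (u * v) = f u * f v.
  pose F1 : {linear A -> B} := f \o (v \o* idfun).
  pose F2 : {linear A -> B} := (f v \o* idfun) \o f.
  rewrite -[LHS]/(F1 u) -[RHS]/(F2 u); apply: basis_ext (HE_basis hA) _ u.
  move=> _ /allpairsP[[g i] [_ _ ->]] /=.
  rewrite fa ?(ltnW (ltn_ord i)) // -!mulrA fj; congr (_ * _).
  elim: (val i) => [|n IHn]; first by rewrite !expr0 !mul1r.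
  by rewrite !exprS -!mulrA fx IHn.
have f1 : f 1 = 1.
  by have := fE 1%g 0%N p_gt0; rewrite (HE_one hA) (HE_one hB) !expr0 !mulr1.
exact: (is_HE_iso_of fE fM f1).
Qed.

End HEUniqueness.

(* Main.v *)
From HB Require Import structures.
Require Import Defs.
From mathcomp Require Import all_boot all_order all_fingroup all_algebra.
From mathcomp Require Import all_solvable all_field zify.
From mathcomp Require boolp.

(** Write H_0 for the coradical, G for the group of group-like elements, and x
    for an element with coproduct x (x) a + 1 (x) x, outside H_0, such that
    a x a^-1 = x + (a - 1).  The claim is that H itself satisfies the defining
    conditions of H_E, so that the isomorphism is the identity.

    Structure of H_1.  As H is pointed, H_0 = kG.  The quotient H_1 / H_0 is a
    G-graded space on which G acts by shifting degrees, so it is determined by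
    its degree 1 part.  A functional on that part extends to a G-invariant
    functional on H_1 (avg), and these functionals together with the counit
    compute the trivial module tensored with H_1 over H_0.  Rank one therefore
    says that the degree 1 part is the line of x (left_coinvariant_line); hence
    H_1 is spanned by the g and the g x (coradical1_span), and an element
    with coproduct y (x) g + 1 (x) y is a multiple of g - 1, or g = a and it is
    a combination of x and a - 1 (skew_primitive_coradical and
    skew_primitive_noncoradical).

    Relations.  Conjugation by g gives g a g^-1 = a and
    g x g^-1 = l x + c(g) (a - 1); comparing with conjugation by a yields l = 1,
    so that c is a homomorphism with c(a) = 1, and p divides the order of a.
    Since a x = x a + (a - 1) a, the operator y |-> y ^ p - y is additive up
    to a twist by a ^ p (artin_schreier_binomial).  It follows that x ^ p - x is
    skew-primitive for a ^ p, hence equal to al (a ^ p - 1) (x_pow), and that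
    c(g) ^ p = c(g) when a ^ p is not 1 (conj_coef_prime_field).

    Basis.  The relations show that the g x ^ i with i < p span H.  They are
    independent because a suitable functional acts on H, up to lower degree in
    x, as differentiation with respect to x (hit_leading), and the integers
    below p are invertible in k (leading_independent).  The antipode is
    determined on the basis by antipode_mulx. *)

Set Implicit Arguments.
Unset Strict Implicit.
Unset Printing Implicit Defensive.

Import GRing.Theory.
Local Open Scope ring_scope.

(** * Rising factorials and the Artin-Schreier operator *)

(** The factors ascend because products of the form y (y + 1) ... (y + n - 1)
    obey a binomial rule in the noncommutative situation below, which powers
    do not, while in characteristic p the product of length p collapses to
    y ^ p - y. *)
Definition rising (R : nzRingType) (y : R) (n : nat) : R :=
  \prod_(i < n) (y + i%:R).

Lemma rising0 (R : nzRingType) (y : R) : rising y 0 = 1.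
Proof. exact: big_ord0. Qed.

Lemma risingS (R : nzRingType) (y : R) n :
  rising y n.+1 = rising y n * (y + n%:R).
Proof. exact: big_ord_recr. Qed.

(** The relation between w and v is the one satisfied by w = a and v = x when
    the group-like a conjugates x to x + (a - 1). *)
Section RisingBinomial.
Variables (R : nzRingType) (X v w : R).
Hypotheses (cXv : GRing.comm X v) (cXw : GRing.comm X w).
Hypothesis wv : w * v + w = v * w + w ^+ 2.

Lemma comm_rising (y z : R) n : GRing.comm y z -> GRing.comm (rising y n) z.
Proof.
move=> cyz; elim: n => [|n IHn].
  by rewrite rising0; apply/commr_sym/commr1.
rewrite risingS; apply: commr_sym; apply: commrM; apply: commr_sym => //.
by apply: commr_sym; apply: commrD; [exact: commr_sym | exact: commr_nat].
Qed.

Lemma expw_mulv j : w ^+ j * v + w ^+ j *+ j = v * w ^+ j + w ^+ j.+1 *+ j.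
Proof.
elim: j => [|j IHj]; first by rewrite !mulr0n !addr0 expr0 mul1r mulr1.
have /(congr1 ( *%R w)) := IHj; rewrite !mulrDr !mulrnAr !mulrA -!exprS => E.
rewrite mulrSr addrA E addrAC {1}exprS -mulrDl wv mulrDl -mulrA -exprS.
by rewrite -exprD addrAC -addrA -mulrSr.
Qed.

(** Moving the new factor across w ^ j splits it as (v + (n - j)) + (X + j) w,
    and each half lengthens exactly one of the two rising products. *)
Lemma rising_step n j : (j <= n)%N ->
  rising X j * rising v (n - j) * w ^+ j * (v + X * w + n%:R) =
  rising X j * rising v (n.+1 - j) * w ^+ j
  + rising X j.+1 * rising v (n - j) * w ^+ j.+1.
Proof.
move=> le_jn; rewrite subSn // !risingS.
have -> : rising X j * rising v (n - j) * w ^+ j * (v + X * w + n%:R) =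
   rising X j * rising v (n - j) *
    ((v + (n - j)%:R) * w ^+ j + (X + j%:R) * w ^+ j.+1).
  rewrite -[LHS]mulrA; congr (_ * _).
  rewrite !mulrDr !mulrDl mulrA -(commrX j cXw) -mulrA -exprSr.
  rewrite mulr_natr !mulr_natl -[in X in _ + _ *+ X](subnK le_jn) mulrnDr.
  rewrite !addrA [LHS](ACl (1*4*3*2)) /= expw_mulv.
  by rewrite [LHS](ACl (1*3*4*2)).
rewrite mulrDr !mulrA; congr (_ + _ * _); rewrite -!mulrA; congr (_ * _).
by apply/comm_rising/commrD; [exact: commr_sym | exact: commr_nat].
Qed.

(** The two halves in rising_step have coefficient 1, so the coefficients
    follow Pascal's rule. *)
Lemma rising_binomial n : rising (v + X * w) n =
  \sum_(j < n.+1) (rising X j * rising v (n - j) * w ^+ j) *+ 'C(n, j).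
Proof.
elim: n => [|n IHn]; rewrite big_ord_recl ?big_ord0 /=.
  by rewrite !rising0 !mulr1 addr0.
rewrite risingS {}IHn mulr_suml.
pose A n' m (j : nat) := rising X j * rising v (m - j) * w ^+ j *+ 'C(n', j).
pose B (j : nat) := rising X j.+1 * rising v (n - j) * w ^+ j.+1 *+ 'C(n, j).
transitivity (\sum_(j < n.+1) (A n n.+1 j + B j)).
  apply: eq_bigr => j _.
  by rewrite mulrnAl rising_step -1?ltnS // mulrnDl.
rewrite big_split /= big_ord_recl -addrA /A !bin0; congr (_ + _).
rewrite [X in _ + X]big_ord_recr addrA -big_split [RHS]big_ord_recr /=.
rewrite /B /bump /= add1n !subnn !binn; congr (_ + _).
by apply: eq_bigr => j _; rewrite add1n subSS binS mulrnDr.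
Qed.

Lemma rising_binomial_pchar p : p \in [pchar R] ->
  rising (v + X * w) p = rising v p + rising X p * w ^+ p.
Proof.
move=> charR; have p_pr := pcharf_prime charR.
rewrite rising_binomial // big_ord_recl bin0 /=.
rewrite -[in X in _ + X](prednK (prime_gt0 p_pr)) big_ord_recr /= /bump /=.
rewrite add1n (prednK (prime_gt0 p_pr)) binn subnn subn0 !rising0.
rewrite mul1r !mulr1 mulr1n big1 ?add0r // => j _; rewrite add1n.
have /dvdnP[m ->] : (p %| 'C(p, j.+1))%N.
  by apply: prime_dvd_bin; rewrite //= -ltn_predRL.
by rewrite mulrnA mulrn_pchar.
Qed.
End RisingBinomial.

(** The elements - i with i < p are p distinct roots of X ^ p - X in k, hence
    all of its roots; the factorization is then evaluated at y. *)
Lemma rising_pchar (k : fieldType) (A : falgType k) p (y : A) :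
  p \in [pchar k] -> rising y p = y ^+ p - y.
Proof.
move=> char_k; have p_pr := pcharf_prime char_k.
suff E : \prod_(i < p) ('X + i%:R) = 'X^p - 'X :> {poly k}.
  have := congr1 (horner_alg y) E; rewrite rmorph_prod rmorphB rmorphXn /=.
  rewrite !horner_algX => <-; apply: eq_bigr => i _.
  by rewrite rmorphD /= horner_algX rmorph_nat.
have sz_p : size ('X^p - 'X : {poly k}) = p.+1.
  by rewrite size_polyDl ?size_polyN ?size_polyXn ?size_polyX ?ltnS ?prime_gt1.
have lead1 : lead_coef ('X^p - 'X : {poly k}) = 1.
  by rewrite lead_coefDl ?lead_coefXn ?size_polyN ?size_polyXn ?size_polyX
             ?ltnS ?prime_gt1.
pose rs : seq k := [seq - (val i)%:R | i <- enum 'I_p].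
have := @all_roots_prod_XsubC _ ('X^p - 'X : {poly k}) rs.
rewrite lead1 scale1r => ->.
- rewrite /rs big_map big_enum; apply: eq_bigr => i _ /=.
  by rewrite polyCN opprK -polyC_natr.
- by rewrite sz_p size_map size_enum_ord.
- apply/allP => _ /mapP[i _ ->].
  rewrite rootE !hornerE -(pFrobenius_autE char_k).
  by rewrite pFrobenius_autN pFrobenius_aut_nat subrr.
rewrite uniq_rootsE map_inj_in_uniq ?enum_uniq // => i j _ _ /oppr_inj eq_ij.
apply: val_inj => /=; wlog le_ij : i j eq_ij / (i <= j)%N => [IH|].
  by case/orP: (leq_total i j) => /IH-> //; rewrite eq_ij.
apply/eqP; rewrite eqn_leq le_ij /= -subn_eq0.
have : (p %| j - i)%N by rewrite (dvdn_pcharf char_k) natrB // eq_ij subrr.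
apply: contraLR; rewrite -lt0n => /gtnNdvd-> //.
exact: leq_ltn_trans (leq_subr _ _) _.
Qed.

(** The Artin-Schreier operator y ^ p - y is additive up to the twist by w ^ p:
    all mixed terms of the binomial formula carry a multiple of p. *)
Lemma artin_schreier_binomial (k : fieldType) (A : falgType k) p (X v w : A) :
    p \in [pchar k] -> GRing.comm X v -> GRing.comm X w ->
    w * v + w = v * w + w ^+ 2 ->
  (v + X * w) ^+ p - (v + X * w) = v ^+ p - v + (X ^+ p - X) * w ^+ p.
Proof.
move=> char_k cXv cXw wv; rewrite -!(rising_pchar _ char_k).
by apply: rising_binomial_pchar => //; rewrite pchar_lalg.
Qed.

(** * Linear maps out of spans and tensor products *)

Section LinearTools.
Variable k : fieldType.
Implicit Types U V W : vectType k.

Lemma mem_cspan_linear V W (f : {linear V -> W}) (S : V -> Prop)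
    (X : {vspace W}) :
  (forall v, S v -> f v \in X) -> forall v, v \in cspan S -> f v \in X.
Proof.
move=> fS v Sv; rewrite -[f v]lfunE memv_preim; move: v Sv; apply/subvP.
by apply: cspan_sub => v /fS; rewrite -memv_preim lfunE.
Qed.

Lemma cspan_linear_eq V W (f g : {linear V -> W}) (S : V -> Prop) :
  (forall v, S v -> f v = g v) -> forall v, v \in cspan S -> f v = g v.
Proof.
move=> fg v /(@mem_cspan_linear _ _ (f \- g) S 0%VS) => /= fgv; apply/eqP.
by rewrite -subr_eq0 -memv0; apply: fgv => u /fg ->; rewrite subrr mem0v.
Qed.

(** Compose the projection along U with the coordinate on the line spanned by
    the image of v. *)
Lemma separating_functional V (U : {vspace V}) v : v \notin U ->
  exists f : {linear V -> k^o}, (forall u, u \in U -> f u = 0) /\ f v = 1.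
Proof.
move=> vU; pose w := v - projv U v.
have w0 : w != 0.
  by apply: contra vU; rewrite subr_eq0 => /eqP->; apply: memv_proj.
pose f u : k^o := coord [tuple w] ord0 (u - projv U u).
have lf : linear f.
  by move=> c u u'; rewrite /f linearP opprD addrACA -scalerBr linearP.
pose F : {linear V -> k^o} := HB.pack f (GRing.isLinear.Build k V k^o _ f lf).
exists F; split=> [u Uu|] /=.
  by rewrite /f projv_id // subrr linear0.
have fw : free [tuple w] by rewrite /= seq1_free.
by have := coord_free ord0 ord0 fw; rewrite /= /f -/w => ->.
Qed.

Lemma dimv_add_line V (U : {vspace V}) v :
  v \notin U -> \dim (U + <[v]>)%VS = (\dim U).+1.
Proof.
move=> vU; have v0 : v != 0 by apply: contraNneq vU => ->; apply: mem0v.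
rewrite dimv_disjoint_sum ?dim_vline ?v0 ?addn1 //.
apply/eqP; rewrite -subv0; apply/subvP => w /memv_capP[Uw /vlineP[c wE]].
rewrite memv0 wE; have [->|c0] := eqVneq c 0; first by rewrite scale0r.
case/negP: vU; rewrite -[v](scalerK c0) -wE; exact: memvZ.
Qed.

Lemma mem_tensorv U V (X : {vspace U}) (Y : {vspace V}) u v :
  u \in X -> v \in Y -> u ⊗ v \in tensorv X Y.
Proof. by move=> Xu Yv; apply: mem_cspan; exists u, v. Qed.

Lemma mem_tensorv_linear U V W (f : {linear tensor U V -> W})
    (X : {vspace U}) (Y : {vspace V}) (Z : {vspace W}) :
    (forall u v, u \in X -> v \in Y -> f (u ⊗ v) \in Z) ->
  forall t, t \in tensorv X Y -> f t \in Z.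
Proof.
by move=> fXY; apply: mem_cspan_linear => _ [u [v [Xu Yv ->]]]; apply: fXY.
Qed.

Lemma tensorv_linear_eq U V W (f g : {linear tensor U V -> W})
    (X : {vspace U}) (Y : {vspace V}) :
    (forall u v, u \in X -> v \in Y -> f (u ⊗ v) = g (u ⊗ v)) ->
  forall t, t \in tensorv X Y -> f t = g t.
Proof.
by move=> fg; apply: cspan_linear_eq => _ [u [v [Xu Yv ->]]]; apply: fg.
Qed.

Lemma tensor_linear_eq U V W (f g : {linear tensor U V -> W}) :
  (forall u v, f (u ⊗ v) = g (u ⊗ v)) -> f =1 g.
Proof. by move=> fg; apply: tensor_ext => //; apply: linearP. Qed.

(** Named so that the two partial applications of the pure tensor carry a
    linear structure. *)
Definition pure_left U V (v : V) (u : U) : tensor U V := u ⊗ v.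
Definition pure_right U V (u : U) (v : V) : tensor U V := u ⊗ v.
HB.instance Definition _ U V (v : V) :=
  GRing.isLinear.Build k U (tensor U V) _
    (@pure_left U V v) ((pure_bilin U V).1 v).
HB.instance Definition _ U V (u : U) :=
  GRing.isLinear.Build k V (tensor U V) _
    (@pure_right U V u) ((pure_bilin U V).2 u).

Lemma pureDl U V (u u' : U) (v : V) : (u + u') ⊗ v = u ⊗ v + u' ⊗ v.
Proof. exact: (linearD (pure_left v)). Qed.
Lemma pureDr U V (u : U) (v v' : V) : u ⊗ (v + v') = u ⊗ v + u ⊗ v'.
Proof. exact: (linearD (pure_right u)). Qed.
Lemma pureBl U V (u u' : U) (v : V) : (u - u') ⊗ v = u ⊗ v - u' ⊗ v.
Proof. exact: (linearB (pure_left v)). Qed.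
Lemma pureBr U V (u : U) (v v' : V) : u ⊗ (v - v') = u ⊗ v - u ⊗ v'.
Proof. exact: (linearB (pure_right u)). Qed.
Lemma pureZl U V c (u : U) (v : V) : (c *: u) ⊗ v = c *: (u ⊗ v).
Proof. by rewrite -[LHS]/(pure_left v _) linearZ. Qed.
Lemma pureZr U V c (u : U) (v : V) : u ⊗ (c *: v) = c *: (u ⊗ v).
Proof. by rewrite -[LHS]/(pure_right u _) linearZ. Qed.

(** The contraction f (x) id, the main tool for reading off tensors: in a
    coalgebra it turns the coproduct into linear operators. *)
Definition slice U V (f : {linear U -> k^o}) : tensor U V -> V :=
  tensor_lift (fun u v => f u *: v).
HB.instance Definition _ U V f :=
  GRing.isLinear.Build k (tensor U V) V _ (@slice U V f) (tensor_lift_linear _).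

Lemma sliceE U V (f : {linear U -> k^o}) u (v : V) :
  slice f (u ⊗ v) = f u *: v.
Proof.
by rewrite /slice (tensor_liftE _ _ (bilin_comp f idfun (@bilin_scale k V))).
Qed.

HB.instance Definition _ U V W :=
  GRing.isLinear.Build k (tensor (tensor U V) W) (tensor U (tensor V W)) _
    (@tensor_assoc k U V W) (tensor_lift_linear _).

Lemma tensor_assoc_pure U V W (s : tensor U V) (w : W) :
  tensor_assoc (s ⊗ w) = tensor_lift (fun u v => u ⊗ (v ⊗ w)) s.
Proof.
rewrite /tensor_assoc tensor_liftE //.
split=> [v|u] c x y; first exact: linearP.
rewrite /tensor_lift scaler_sumr -big_split; apply: eq_bigr => i _.
rewrite scaler_sumr -big_split; apply: eq_bigr => j _ /=.
by rewrite !(pure_bilin _ _).2 scalerDr !scalerA [_ * c]mulrC.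
Qed.

Lemma bilin_assoc U V W (w : W) : bilin (fun (u : U) (v : V) => u ⊗ (v ⊗ w)).
Proof. exact: (bilin_comp idfun (pure_left w) (pure_bilin _ _)). Qed.

Lemma tensor_assocE U V W (u : U) (v : V) (w : W) :
  tensor_assoc (u ⊗ v ⊗ w) = u ⊗ (v ⊗ w).
Proof.
by rewrite tensor_assoc_pure (tensor_liftE _ _ (@bilin_assoc U V W w)).
Qed.

HB.instance Definition _ U V U' V' (f : {linear U -> U'})
    (g : {linear V -> V'}) :=
  GRing.isLinear.Build k (tensor U V) (tensor U' V') _
    (tensor_map f g) (tensor_lift_linear _).

Lemma tensor_mapE U V U' V' (f : {linear U -> U'}) (g : {linear V -> V'}) u v :
  tensor_map f g (u ⊗ v) = f u ⊗ g v.
Proof.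
by rewrite /tensor_map (tensor_liftE _ _ (bilin_comp f g (pure_bilin _ _))).
Qed.

Lemma slice_assoc U V W (f : {linear U -> k^o}) (s : tensor U V) (w : W) :
  slice f (tensor_assoc (s ⊗ w)) = slice f s ⊗ w.
Proof.
apply: (@tensor_linear_eq U V _
  (slice f \o (@tensor_assoc k U V W \o pure_left w))
  (pure_left w \o slice f)) => u v.
by rewrite /= /pure_left tensor_assocE !sliceE pureZl.
Qed.

Lemma slice_map_r U V W (f : {linear U -> k^o}) (F : {linear V -> W})
    (t : tensor U V) :
  slice f (tensor_map idfun F t) = F (slice f t).
Proof.
apply: (@tensor_linear_eq U V _ (slice f \o tensor_map idfun F)
  (F \o slice f)).
by move=> u v; rewrite /= tensor_mapE !sliceE linearZ.
Qed.

End LinearTools.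

Lemma pureX (k : fieldType) (A B : falgType k) (u : A) (v : B) n :
  (u ⊗ v) ^+ n = (u ^+ n) ⊗ (v ^+ n).
Proof. by elim: n => [|n IHn]; rewrite ?expr0 // !exprS IHn pureM. Qed.

(** * The coradical of a pointed Hopf algebra *)

Section Coradical.
Variables (k : fieldType) (H : hopfAlgType k).
Local Notation H0 := (coradical H).
Implicit Types g h : grouplike H.

Lemma glX g n : ((g ^+ n)%g : H) = (g : H) ^+ n.
Proof.
by elim: n => [|n IHn]; rewrite ?expg0 ?expr0 // expgS exprS -IHn.
Qed.

Lemma glVK g (u : H) : (g : H)^-1 * ((g : H) * u) = u.
Proof. by rewrite mulrA mulVr ?mul1r ?gl_unit. Qed.

Lemma glKV g (u : H) : (g : H) * ((g : H)^-1 * u) = u.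
Proof. by rewrite mulrA mulrV ?mul1r ?gl_unit. Qed.

Lemma gl_coradical g : (g : H) \in H0.
Proof.
apply: mem_cspan; exists <[g : H]>%VS; last exact: memv_line.
split=> [h /vlineP[c ->]||D _ DC].
- by rewrite linearZ /= gl_comul memvZ // mem_tensorv ?memv_line.
- by rewrite -dimv_eq0 dim_vline gl_neq0.
have [->|D0] := eqVneq D 0%VS; [by left | right; apply/eqP].
by rewrite eqEdim DC dim_vline gl_neq0 lt0n dimv_eq0.
Qed.

Lemma one_coradical : 1 \in H0.
Proof. exact: (gl_coradical (1%g : grouplike H)). Qed.

Hypothesis pointed_H : pointed H.

(** A one-dimensional subcoalgebra is spanned by some c whose coproduct is a
    multiple of c (x) c; the counit axiom makes that multiple invertible, so
    c can be rescaled to a group-like element. *)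
Lemma coradical_gl : H0 = cspan (fun u => exists g, u = g :> H).
Proof.
apply/eqP; rewrite eqEsubv; apply/andP; split; last first.
  by apply: cspan_sub => _ [g ->]; apply: gl_coradical.
apply: cspan_sub => h [C simC hC]; have [subC C0 _] := simC.
pose c := vpick C; have Cc : c \in C := memv_pick C.
have c0 : c != 0 by rewrite vpick0.
have CE : C = <[c]>%VS.
  by apply/esym/eqP; rewrite eqEdim -memvE Cc (pointed_H simC) dim_vline c0.
have /vlineP[l Dc] : comul c \in <[c ⊗ c]>%VS.
  rewrite -[comul c]/(idfun (comul c)).
  apply: (mem_tensorv_linear _ (subC c Cc)) => u v.
  rewrite CE => /vlineP[a ->] /vlineP[b ->] /=; apply/vlineP; exists (a * b).
  by rewrite pureZl pureZr scalerA.
have le1 : l * counit c = 1.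
  have := counitl c; rewrite Dc linearZ /= -[tensor_lift _ _]/(slice counit _).
  rewrite sliceE scalerA => E; apply/eqP.
  have : (l * counit c - 1) *: c == 0 by rewrite scalerBl E scale1r subrr.
  by rewrite scaler_eq0 (negPf c0) orbF subr_eq0.
have l0 : l != 0.
  by apply: contra_eq_neq le1 => ->; rewrite mul0r eq_sym oner_eq0.
have gP : is_grouplike (l *: c).
  rewrite /is_grouplike linearZ /= Dc pureZl pureZr eqxx.
  by rewrite scaler_eq0 negb_or l0 c0.
move: hC; rewrite CE => /vlineP[m ->].
have -> : c = l^-1 *: (Grouplike gP : H).
  by rewrite /= scalerA mulVf // scale1r.
by do 2!apply: memvZ; apply: mem_cspan; exists (Grouplike gP).
Qed.

Lemma mem_coradical_linear (W : vectType k) (f : {linear H -> W})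
    (X : {vspace W}) :
  (forall g, f (g : H) \in X) -> forall b, b \in H0 -> f b \in X.
Proof. by rewrite coradical_gl => fX; apply: mem_cspan_linear => _ [g ->]. Qed.

Lemma coradical_linear_eq (W : vectType k) (f f' : {linear H -> W}) :
  (forall g, f (g : H) = f' (g : H)) -> forall b, b \in H0 -> f b = f' b.
Proof. by rewrite coradical_gl => ff'; apply: cspan_linear_eq => _ [g ->]. Qed.

Lemma coradicalMl g b : b \in H0 -> (g : H) * b \in H0.
Proof.
apply: (@mem_coradical_linear _ ((g : H) \*o idfun)) => h /=.
exact: (gl_coradical (g * h)%g).
Qed.

Lemma coradicalMr g b : b \in H0 -> b * (g : H) \in H0.
Proof.
apply: (@mem_coradical_linear _ ((g : H) \o* idfun)) => h /=.
exact: (gl_coradical (h * g)%g).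
Qed.

Lemma gl_mul_tensorv g t :
  t \in tensorv {:H} H0 -> (g : H) ⊗ (g : H) * t \in tensorv {:H} H0.
Proof.
move: t; apply: (@mem_tensorv_linear _ _ _ _ (((g : H) ⊗ (g : H)) \*o idfun)).
by move=> u v _ vH0; rewrite /= pureM mem_tensorv ?memvf ?coradicalMl.
Qed.

Definition gl_seq := [seq (g : H) | g <- enum {: grouplike H}].

Lemma gl_seq_index g : (index g (enum {: grouplike H}) < size gl_seq)%N.
Proof. by rewrite size_map index_mem mem_enum. Qed.

(** The functionals dual to the group-like elements.  Their values off the
    coradical are arbitrary; each use removes the ambiguity by means of a
    functional that vanishes on the coradical or by working modulo it. *)
Definition gl_dual g : H -> k^o :=
  coord (in_tuple gl_seq) (Ordinal (gl_seq_index g)).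

Lemma gl_dual_linear g : linear (gl_dual g).
Proof. by move=> c u v; rewrite /gl_dual linearP. Qed.
HB.instance Definition _ g :=
  GRing.isLinear.Build k H k^o _ (gl_dual g) (gl_dual_linear g).

Lemma gl_dualE g h : gl_dual g (h : H) = (h == g)%:R.
Proof.
have hE : (h : H) = (in_tuple gl_seq)`_(Ordinal (gl_seq_index h)).
  by rewrite /= (nth_map h) ?nth_index ?index_mem ?mem_enum.
have fr : free (in_tuple gl_seq) := gl_free (enum_uniq {: grouplike H}).
rewrite hE /gl_dual coord_free //.
congr (nat_of_bool _)%:R; apply/eqP/eqP => [/(congr1 val)/= E|-> //].
have := congr1 (nth h (enum {: grouplike H})) E.
by rewrite !nth_index ?mem_enum.
Qed.

Lemma coradical_sum (b : H) :
  b \in H0 -> b = \sum_g (gl_dual g b : k) *: (g : H).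
Proof.
pose F (u : H) : H := \sum_g (gl_dual g u : k) *: (g : H).
have lF : linear F.
  move=> c u v; rewrite /F scaler_sumr -big_split; apply: eq_bigr => g _ /=.
  by rewrite linearP scalerDl scalerA.
pose F' : {linear H -> H} := HB.pack F (GRing.isLinear.Build k H H _ F lF).
apply: (@coradical_linear_eq H idfun F') b => g /=.
rewrite /F (bigD1 g) //= big1 => [|h hg]; rewrite gl_dualE.
  by rewrite eqxx scale1r addr0.
by rewrite eq_sym (negPf hg) scale0r.
Qed.

Lemma slice_counit (u : H) : @slice k H H counit (comul u) = u.
Proof. exact: counitl. Qed.

Lemma slice_gl_dual g b : b \in H0 ->
  @slice k H _ (gl_dual g) (comul b) = (gl_dual g b : k) *: (g : H).
Proof.
pose F u : H := (gl_dual g u : k) *: (g : H).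
have lF : linear F by move=> c u v; rewrite /F linearP scalerDl scalerA.
pose F2 : {linear H -> H} := HB.pack F (GRing.isLinear.Build k H H _ F lF).
move: b; apply: (@coradical_linear_eq _
  (@slice k H _ (gl_dual g) \o comul) F2) => h.
rewrite /F2 /= /F gl_comul sliceE /=; have [-> //|hg] := eqVneq h g.
have E : gl_dual g (h : H) = 0 by rewrite gl_dualE (negPf hg).
by rewrite E !scale0r.
Qed.

Lemma slice_coradical0 (f : {linear H -> k^o}) b :
  (forall u, u \in H0 -> f u = 0) -> b \in H0 -> slice f (comul b) = 0.
Proof.
move=> f0; move: b.
apply: (@coradical_linear_eq _ (@slice k H H f \o comul) \0) => h.
by rewrite /= gl_comul sliceE f0 ?scale0r ?gl_coradical.
Qed.

End Coradical.

(** * Invariant functionals on the first term of the coradical filtration *)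

Section Averaging.
Variables (k : fieldType) (H : hopfAlgType k).
Local Notation H0 := (coradical H).
Local Notation H1 := (coradical1 H).
Implicit Types g h : grouplike H.

Lemma mem_coradical1 (m : H) :
  (m \in H1) = (comul m \in tensorv {:H} H0 + tensorv H0 {:H})%VS.
Proof. by rewrite /coradical1 -memv_preim lfunE. Qed.

(** This says that the class of y in H_1 / H_0 is a coinvariant of degree 1 for
    the left coaction of H_0. *)
Definition left_coinvariant (y : H) : Prop :=
  comul y - 1 ⊗ y \in tensorv {:H} H0.

(** In Sweedler notation, avg f m is the sum over g of delta_g (m_1) times
    f (g^-1 m_2), where delta_g is dual to g.  When f vanishes on H_0 this is
    the extension of f from the degree 1 part of H_1 / H_0 to a functional
    invariant under left multiplication by group-likes: the explicit form of
    the fundamental theorem of Hopf modules for H_0 acting on H_1 / H_0. *)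
Definition avg_tensor (f : {linear H -> k^o}) (t : tensor H H) : k^o :=
  \sum_(g : grouplike H) f ((g : H)^-1 * @slice k H H (gl_dual g) t).

Lemma avg_tensor_linear f : linear (avg_tensor f).
Proof.
move=> c s t; rewrite /avg_tensor scaler_sumr -big_split.
apply: eq_bigr => g _ /=.
by rewrite linearP mulrDr -scalerAr linearP.
Qed.
HB.instance Definition _ f :=
  GRing.isLinear.Build k (tensor H H) k^o _
    (avg_tensor f) (avg_tensor_linear f).

Definition avg (f : {linear H -> k^o}) (m : H) : k^o :=
  avg_tensor f (comul m).

Lemma avg_linear f : linear (avg f).
Proof. by move=> c u v; rewrite /avg !linearP. Qed.
HB.instance Definition _ f :=
  GRing.isLinear.Build k H k^o _ (avg f) (avg_linear f).

Lemma avg_tensor_pure f (u v : H) :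
  avg_tensor f (u ⊗ v) =
  \sum_(g : grouplike H) gl_dual g u *: f ((g : H)^-1 * v).
Proof. by apply: eq_bigr => g _; rewrite sliceE -scalerAr linearZ. Qed.

Lemma avg_tensor_gl f h (v : H) :
  avg_tensor f ((h : H) ⊗ v) = f ((h : H)^-1 * v).
Proof.
rewrite avg_tensor_pure (bigD1 h) //= big1 => [|g gh]; rewrite gl_dualE.
  by rewrite eqxx scale1r addr0.
by rewrite eq_sym (negPf gh) scale0r.
Qed.

Hypothesis pointed_H : pointed H.
Variable f : {linear H -> k^o}.
Hypothesis f_H0 : forall b, b \in H0 -> f b = 0.

Lemma avg_tensor_H0 t : t \in tensorv {:H} H0 -> avg_tensor f t = 0.
Proof.
move=> Ht; apply/eqP; rewrite -memv0.
apply: (mem_tensorv_linear _ Ht) => u v _ vH0.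
rewrite memv0 /= avg_tensor_pure big1 // => g _.
by rewrite -[(g : H)^-1]/((g^-1)%g : H) f_H0 ?scaler0 ?coradicalMl.
Qed.

(** On H (x) H_0 both sides vanish; on H_0 (x) H the substitution of g h for h
    in the sum cancels the two factors g. *)
Lemma avg_tensor_shift g t :
    t \in (tensorv {:H} H0 + tensorv H0 {:H})%VS ->
  avg_tensor f ((g : H) ⊗ (g : H) * t) = avg_tensor f t.
Proof.
case/memv_addP=> t1 Ht1 [t2 Ht2 ->]; rewrite mulrDr !linearD /=.
congr (_ + _); first by rewrite !avg_tensor_H0 ?gl_mul_tensorv.
pose F : {linear tensor H H -> k^o} :=
  avg_tensor f \o (((g : H) ⊗ (g : H)) \*o idfun).
rewrite -[LHS]/(F t2); apply: (tensorv_linear_eq _ Ht2) => u v uH0 _.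
rewrite -[u ⊗ v]/(pure_left v u).
pose F1 : {linear H -> k^o} := F \o pure_left v.
pose F2 : {linear H -> k^o} := avg_tensor f \o pure_left v.
rewrite -[LHS]/(F1 u) -[RHS]/(F2 u); move: u uH0.
apply: coradical_linear_eq => // h.
rewrite /F1 /F2 /F /= /pure_left pureM.
rewrite -[(g : H) * (h : H)]/((g * h)%g : H) !avg_tensor_gl.
have -> : ((g * h)%g : H)^-1 = (h : H)^-1 * (g : H)^-1.
  by rewrite -invrM ?gl_unit.
by rewrite -mulrA glVK.
Qed.

Lemma avg_glM g m : m \in H1 -> avg f ((g : H) * m) = avg f m.
Proof.
rewrite mem_coradical1 => Hm.
by rewrite /avg rmorphM /= gl_comul avg_tensor_shift.
Qed.

(** Consequently avg f factors through the trivial module tensored with H_1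
    over H_0, where the rank is measured. *)
Lemma avg_H0M b m : b \in H0 -> m \in H1 -> avg f (b * m) = counit b *: avg f m.
Proof.
move=> bH0 mH1; pose F1 : {linear H -> k^o} := avg f \o (m \o* idfun).
pose F (u : H) : k^o := counit u * avg f m.
have lF : linear F.
  by move=> c u v; rewrite /F linearP mulrDl scalerAl.
pose F2 : {linear H -> k^o} := HB.pack F (GRing.isLinear.Build k H k^o _ F lF).
move: b bH0; apply: (@coradical_linear_eq _ _ pointed_H _ F1 F2) => g.
by rewrite /F1 /F2 /= /F avg_glM // gl_counit mul1r.
Qed.

Lemma avg_coinvariant y : left_coinvariant y -> avg f y = f y.
Proof.
move=> Hy; rewrite /avg -[comul y](subrK (1 ⊗ y)) linearD /= avg_tensor_H0 //.
rewrite add0r; apply: etrans (avg_tensor_gl f 1%g y) _.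
by rewrite /= invr1 mul1r.
Qed.

Lemma avg_gl g : avg f (g : H) = 0.
Proof.
rewrite /avg gl_comul avg_tensor_gl mulVr ?gl_unit //.
exact: f_H0 (gl_coradical 1%g).
Qed.
End Averaging.

(** * Consequences of rank one *)

Section RankOneStructure.
Variables (k : fieldType) (H : hopfAlgType k).
Local Notation H0 := (coradical H).
Local Notation H1 := (coradical1 H).
Implicit Types g h : grouplike H.

Lemma left_coinvariant_coradical1 y : left_coinvariant y -> y \in H1.
Proof.
move=> Hy; rewrite mem_coradical1 -(subrK (1 ⊗ y) (comul y)) memv_add //.
by rewrite mem_tensorv ?memvf ?one_coradical.
Qed.

Lemma skew_left_coinvariant g y : skew_primitive g 1%g y -> left_coinvariant y.
Proof.
move=> Dy; rewrite /left_coinvariant Dy /= addrK.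
by rewrite mem_tensorv ?memvf ?gl_coradical.
Qed.

Lemma skew_counit g h (y : H) : skew_primitive g h y -> counit y = 0.
Proof.
move=> Dy; have := counitl y; rewrite -[tensor_lift _ _]/(slice counit _) Dy.
rewrite linearD /= !sliceE /= gl_counit scale1r => /eqP.
by rewrite -subr_eq0 addrK scaler_eq0 (negPf (gl_neq0 g)) orbF => /eqP.
Qed.

Hypothesis pointed_H : pointed H.

Lemma coradical1Ml b m : b \in H0 -> m \in H1 -> b * m \in H1.
Proof.
move=> bH0 mH1; move: b bH0.
apply: (@mem_coradical_linear _ _ pointed_H _ (m \o* idfun)) => g /=.
move: mH1; rewrite !mem_coradical1 rmorphM /= gl_comul.
case/memv_addP=> t1 Ht1 [t2 Ht2 ->]; rewrite mulrDr; apply: memv_add.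
  exact: gl_mul_tensorv.
apply: (@mem_tensorv_linear _ _ _ _ (((g : H) ⊗ (g : H)) \*o idfun)
  _ _ _ _ _ Ht2).
by move=> u v uH0 _; rewrite /= pureM mem_tensorv ?memvf ?coradicalMl.
Qed.

Lemma balancing_sub :
  (balancing_relations H0 H1 <= tensorv {:k^o} H1)%VS.
Proof.
apply: cspan_sub => _ [l [b [n [bH0 nH1 ->]]]].
by rewrite memvB // mem_tensorv ?memvf ?coradical1Ml.
Qed.

(** Contracting the scalar leg identifies k (x) H with H; an H_0-invariant
    functional then kills the balancing relations. *)
Lemma balancing_functional (f : {linear H -> k^o}) :
    (forall b n, b \in H0 -> n \in H1 -> f (b * n) = counit b *: f n) ->
  forall t, t \in balancing_relations H0 H1 -> f (slice idfun t) = 0.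
Proof.
move=> fM t; rewrite -[RHS]/((\0 : {linear _ -> k^o}) t).
rewrite -[LHS]/((f \o @slice k k^o H idfun) t).
apply: cspan_linear_eq => _ [l [b [n [bH0 nH1 ->]]]].
rewrite /= linearB /= !sliceE linearB /= !linearZ /= fM //.
by rewrite scalerN scalerA subrr.
Qed.

Hypothesis rank_one_H : has_rank H 1.
Variable x : H.
Hypotheses (x_coinv : left_coinvariant x) (xNH0 : x \notin H0).

(** The one use of the rank hypothesis.  If y were outside H_0 + k x, averaged
    functionals and the counit would separate the classes of 1, x and y in the
    trivial module tensored with H_1 over H_0, whose dimension is only 2. *)
Lemma left_coinvariant_line y :
  left_coinvariant y -> y \in (H0 + <[x]>)%VS.
Proof.
move=> y_coinv; apply: contraT => yNH0x.
pose e (u : H) : tensor k^o H := (1 : k^o) ⊗ u.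
set B := balancing_relations H0 H1.
have indep al be ga : al *: e 1 + be *: e x + ga *: e y \in B ->
    [/\ al = 0, be = 0 & ga = 0].
  move=> tB; set t := (_ + _) in tB.
  have st : slice idfun t = al *: 1 + (be *: x + ga *: y).
    by rewrite /t !linearD !linearZ /= !sliceE !scale1r addrA.
  (* otherwise some f kills H_0 but not this vector, and avg f kills t *)
  have bxgyH0 : be *: x + ga *: y \in H0.
    apply: contraT => /separating_functional[f [f0 f1]].
    have : avg f (slice idfun t) = 0 :=
      balancing_functional (avg_H0M pointed_H f0) tB.
    rewrite st [LHS](linearD (avg f)) linearZ /= (avg_gl f0 1%g) scaler0 add0r.
    rewrite avg_coinvariant ?f1 //; first by move/eqP; rewrite oner_eq0.
    rewrite /left_coinvariant linearD !linearZ /= pureDr !pureZr.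
    rewrite opprD addrACA -!scalerBr.
    by rewrite memvD ?memvZ.
  have ga0 : ga = 0.
    apply/eqP; apply: contraNT yNH0x => ga0; rewrite -[y](scalerK ga0) memvZ //.
    rewrite -[ga *: y](addKr (be *: x)) addrC memv_add //.
    by rewrite memvN memvZ // memv_line.
  have be0 : be = 0.
    move: bxgyH0; rewrite ga0 scale0r addr0; have [//|be0] := eqVneq be 0.
    by move=> bxH0; case/negP: xNH0; rewrite -[x](scalerK be0) memvZ.
  split=> //; have := @balancing_functional counit _ t tB.
  rewrite st be0 ga0 !scale0r !addr0 linearZ /= rmorph1 => E.
  by rewrite -[al]mulr1; apply: E => b n _ _; rewrite rmorphM.
have H1e u : u \in H1 -> (<[e u]> <= tensorv {:k^o} H1)%VS.
  by move=> uH1; rewrite -memvE mem_tensorv ?memvf.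
have H1_1 : 1 \in H1.
  apply: left_coinvariant_coradical1.
  by rewrite /left_coinvariant rmorph1 subrr mem0v.
have : (B + <[e 1%R]> + <[e x]> + <[e y]> <= tensorv {:k^o} H1)%VS.
  have xH1 := left_coinvariant_coradical1 x_coinv.
  have yH1 := left_coinvariant_coradical1 y_coinv.
  by rewrite !subv_add !H1e // balancing_sub.
move/dimvS; rewrite !dimv_add_line; first last.
- apply/negP => /memv_addP[_ /memv_addP[b bB [_ /vlineP[al ->] ->]]].
  case=> _ /vlineP[be ->] ey.
  have [|_ _ /eqP] := indep (- al) (- be) 1; last by rewrite oner_eq0.
  by rewrite scale1r ey !scaleNr -opprD addrC -[b + _ + _]addrA addrK.
- apply/negP => /memv_addP[b bB [_ /vlineP[al ->] ex]].
  have [|_ /eqP] := indep (- al) 1 0; last by rewrite oner_eq0.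
  by rewrite scale0r addr0 scale1r ex scaleNr addrC addrK.
- apply/negP => eB; have [|/eqP] := indep 1 0 0; last by rewrite oner_eq0.
  by rewrite !scale0r !addr0 scale1r.
by move: rank_one_H; rewrite /has_rank /dim_trivial_tensor -/B; lia.
Qed.
End RankOneStructure.

(** * The first term of the coradical filtration and its skew-primitives *)

Section CoradicalFiltration.
Variables (k : fieldType) (H : hopfAlgType k).
Local Notation H0 := (coradical H).
Local Notation H1 := (coradical1 H).
Implicit Types g h : grouplike H.
Hypotheses (pointed_H : pointed H) (rank_one_H : has_rank H 1).

(** A representative of the degree g component of the class of m in the graded
    space H_1 / H_0. *)
Definition gl_component g (m : H) : H := @slice k H _ (gl_dual g) (comul m).

(** Coassociativity makes gl_component g a projection onto degree g modulo H_0: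
    contracting the first leg of the two iterated coproducts by gl_dual g gives
    the coproduct of the component on one side and, modulo H (x) H_0, the
    tensor g (x) (component) on the other. *)
Lemma gl_component_coinvariant g m : m \in H1 ->
  comul (gl_component g m) - (g : H) ⊗ gl_component g m \in tensorv {:H} H0.
Proof.
rewrite mem_coradical1 /gl_component => Hm.
rewrite -(slice_map_r _ comul) -[tensor_map idfun _ _]comulA.
move: Hm; move: (comul m) => t /memv_addP[t1 Ht1 [t2 Ht2 ->{t}]].
pose F : {linear tensor H H -> tensor H H} :=
  @slice k H _ (gl_dual g) \o (@tensor_assoc k H H H \o tensor_map comul idfun).
have FE u v : F (u ⊗ v) = gl_component g u ⊗ v.
  by rewrite /F /= tensor_mapE slice_assoc.
rewrite !linearD /= pureDr opprD addrACA; apply: memvD.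
  apply: memvB.
    apply: (@mem_tensorv_linear _ _ _ _ F _ _ _ _ _ Ht1) => u v _ vH0.
    by rewrite FE mem_tensorv ?memvf.
  rewrite mem_tensorv ?memvf //.
  apply: (@mem_tensorv_linear _ _ _ _ (@slice k H H (gl_dual g)) _ _ _ _ _ Ht1).
  by move=> u v _ vH0; rewrite /= sliceE memvZ.
rewrite -[slice _ (tensor_assoc _)]/(F t2).
suff -> : F t2 = (g : H) ⊗ @slice k H _ (gl_dual g) t2.
  by rewrite subrr mem0v.
apply: (@tensorv_linear_eq k H H _ F
  (pure_right (g : H) \o @slice k H _ (gl_dual g)) _ _ _ _ Ht2).
move=> u v uH0 _; rewrite FE /gl_component slice_gl_dual //= /pure_right sliceE.
by rewrite pureZl pureZr.
Qed.

Variable x : H.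
Hypotheses (x_coinv : left_coinvariant x) (xNH0 : x \notin H0).

Definition gl_or_glx (u : H) : Prop :=
  exists g, u = (g : H) \/ u = (g : H) * x.

(** Modulo H_0 an element of H_1 is the sum of its components, and g^-1 times
    the degree g component is left coinvariant, hence in H_0 + k x. *)
Lemma coradical1_span : (H1 <= cspan gl_or_glx)%VS.
Proof.
set C := cspan _.
have H0C u : u \in H0 -> u \in C.
  apply: (@mem_coradical_linear k H pointed_H _ idfun) => g; apply: mem_cspan.
  by exists g; left.
apply/subvP=> m mH1.
rewrite -(subrK (\sum_(g : grouplike H) gl_component g m) m); apply: memvD.
  (* the sum of the gl_dual g agrees with the counit on H_0 *)
  apply: H0C; rewrite -{1}(slice_counit m) /gl_component.
  move: mH1; rewrite mem_coradical1; move: (comul m) => t.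
  pose F (t : tensor H H) : H := @slice k H H counit t
    - \sum_(g : grouplike H) @slice k H H (gl_dual g) t.
  have lF : linear F.
    move=> c u v; rewrite /F.
    under eq_bigr => g _ do rewrite linearP /=.
    by rewrite big_split -scaler_sumr linearP scalerBr addrACA -opprD.
  pose F' : {linear tensor H H -> H} :=
    HB.pack F (GRing.isLinear.Build k (tensor H H) H _ F lF).
  case/memv_addP=> t1 Ht1 [t2 Ht2 ->{t}].
  rewrite -[_ - _]/(F' _) linearD memvD //.
    apply: (mem_tensorv_linear _ Ht1) => u v _ vH0.
    rewrite /= /F sliceE memvB ?memvZ //.
    by apply: memv_suml => g _; rewrite sliceE memvZ.
  suff -> : F' t2 = (\0 : {linear tensor H H -> H}) t2 by apply: mem0v.
  apply: (tensorv_linear_eq _ Ht2) => u v uH0 _.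
  rewrite /= /F sliceE; under eq_bigr => g _ do rewrite sliceE /=.
  rewrite -scaler_suml.
  rewrite {1}(coradical_sum pointed_H uH0) linear_sum /= -scalerBl.
  rewrite (eq_bigr (fun g => gl_dual g u)) ?subrr ?scale0r // => g _.
  by rewrite linearZ /= gl_counit; apply: mulr1.
apply: memv_suml => g _.
pose y := ((g^-1)%g : H) * gl_component g m.
have y_coinv : left_coinvariant y.
  have := gl_component_coinvariant g mH1.
  rewrite /left_coinvariant /y rmorphM /=.
  rewrite (gl_comul (g^-1)%g : comul (g : H)^-1 = (g : H)^-1 ⊗ (g : H)^-1).
  move: (comul (gl_component g m)) => t Ht.
  have -> : 1 ⊗ ((g : H)^-1 * gl_component g m)
      = ((g : H)^-1 ⊗ (g : H)^-1) * ((g : H) ⊗ gl_component g m).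
    by rewrite pureM mulVr ?gl_unit.
  by rewrite -mulrBr; apply: (gl_mul_tensorv pointed_H (g^-1)%g).
have /memv_addP[b bH0 [_ /vlineP[l ->] yE]] :=
  left_coinvariant_line pointed_H rank_one_H x_coinv xNH0 y_coinv.
rewrite -(glKV g (gl_component g m)) -/y yE mulrDr memvD //.
  by apply: H0C; apply: coradicalMl.
by rewrite -scalerAr memvZ // mem_cspan //; exists g; right.
Qed.

Variable a : grouplike H.
Hypothesis Dx : skew_primitive a 1%g x.

(** For y in H_0 the contraction of the coproduct by the dual of 1 is a multiple
    of 1; computing it from the skew-primitive formula solves for y. *)
Lemma skew_primitive_coradical g y : skew_primitive g 1%g y -> y \in H0 ->
  exists c : k, y = c *: ((g : H) - 1).
Proof.
move=> Dy yH0; exists (- gl_dual 1%g y).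
have := slice_gl_dual pointed_H 1%g yH0; rewrite Dy linearD /= !sliceE /=.
have -> : gl_dual 1%g (1 : H) = 1 by rewrite (gl_dualE 1%g 1%g) eqxx.
by rewrite scale1r => E; rewrite scaleNr scalerBr opprB -E addrC addKr.
Qed.

(** A functional that kills H_0 and not x extracts the group-like on the right
    of the coproduct: g when applied to y, and a when applied to its expansion
    along x.  So a is the only skew point. *)
Lemma skew_primitive_noncoradical g y : skew_primitive g 1%g y -> y \notin H0 ->
  g = a /\ exists l c : k, y = l *: x + c *: ((a : H) - 1).
Proof.
move=> Dy yNH0.
have /memv_addP[b bH0 [_ /vlineP[l ->] yE]] :=
  left_coinvariant_line pointed_H rank_one_H x_coinv xNH0
    (skew_left_coinvariant Dy).
have l0 : l != 0 by apply: contraNneq yNH0 => l0; rewrite yE l0 scale0r addr0.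
have [f [f0 f1]] := separating_functional xNH0.
have f1H : f 1 = 0 := f0 1 (@one_coradical k H).
have fy : f y = l by rewrite yE linearD linearZ /= f0 // f1 add0r; apply: mulr1.
have ga : g = a.
  apply: val_inj; apply: (scalerI l0) => /=.
  have : slice f (comul y) = l *: (a : H).
    rewrite yE linearD linearZ /= linearD linearZ /= slice_coradical0 // Dx.
    by rewrite linearD /= !sliceE f1 f1H scale0r addr0 add0r scale1r.
  by rewrite Dy linearD /= !sliceE fy f1H scale0r addr0.
split=> //; exists l; have [|c bE] := @skew_primitive_coradical a b _ bH0.
  move: Dy; rewrite /skew_primitive ga /= yE linearD linearZ /= Dx /=.
  by rewrite pureDl pureDr pureZl pureZr scalerDr addrACA => /addIr.
by exists c; rewrite yE addrC bE.
Qed.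
End CoradicalFiltration.

(** * The relations satisfied by x *)

Section PowerOfX.
Variables (k : fieldType) (p : nat) (H : hopfAlgType k).
Hypothesis char_k : p \in [pchar k].

Variables (a : grouplike H) (x : H).
Hypothesis Dx : skew_primitive a 1%g x.
Hypothesis ax : (a : H) * x * (a : H)^-1 = x + ((a : H) - 1).

Lemma ax_xa : (a : H) * x + (a : H) = x * (a : H) + (a : H) ^+ 2.
Proof.
have := congr1 (fun u => u * (a : H)) ax.
rewrite /= -mulrA mulVr ?gl_unit // mulr1 mulrDl mulrBl mul1r => ->.
by rewrite addrA subrK expr2.
Qed.

(** The coproduct of x is v + X w with X = x (x) 1, v = 1 (x) x, w = 1 (x) a. *)
Lemma skew_artin_schreier : skew_primitive (a ^+ p)%g 1%g (x ^+ p - x).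
Proof.
rewrite /skew_primitive glX /= rmorphB rmorphXn /= Dx /=.
have -> : x ⊗ (a : H) + 1 ⊗ x = 1 ⊗ x + (x ⊗ 1) * (1 ⊗ (a : H)).
  by rewrite pureM mulr1 mul1r addrC.
rewrite (artin_schreier_binomial char_k).
- by rewrite !pureX !expr1n -pureBr -pureBl pureM mulr1 mul1r addrC.
- by rewrite /GRing.comm !pureM !mulr1 !mul1r.
- by rewrite /GRing.comm !pureM !mulr1 !mul1r.
by rewrite !pureM expr2 pureM !mulr1 -!pureDr ax_xa.
Qed.

Lemma artin_schreier_translate (c : k) :
  let y := x + c *: ((a : H) - 1) in
  y ^+ p - y = x ^+ p - x + (c ^+ p - c) *: ((a : H) ^+ p - 1).
Proof.
move=> /=; set v := x - c%:A.
have comA u : GRing.comm (c%:A : H) u.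
  by rewrite /GRing.comm mulr_algl mulr_algr.
have -> : x + c *: ((a : H) - 1) = v + c%:A * (a : H).
  by rewrite mulr_algl scalerBr [_ - c%:A]addrC addrA.
have cpA : (c%:A : H) ^+ p - c%:A = (c ^+ p - c)%:A.
  by rewrite exprZn expr1n scalerBl.
(* with w = 1 the binomial formula is the additivity of the operator *)
have Ev : x ^+ p - x = v ^+ p - v + (c ^+ p - c)%:A.
  have v1 : 1 * v + 1 = v * 1 + 1 ^+ 2 by rewrite mul1r mulr1 expr1n.
  have := artin_schreier_binomial char_k (comA v) (comA 1) v1.
  by rewrite expr1n !mulr1 cpA /v subrK.
rewrite (artin_schreier_binomial char_k) //; last first.
  by rewrite /v mulrBr mulrBl -comA addrAC ax_xa addrAC.
rewrite cpA Ev mulr_algl scalerBr -[RHS]addrA; congr (_ + _).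
by rewrite addrCA subrr addr0.
Qed.

(** The product of the c + i for i < p equals c ^ p - c, so some factor is 0. *)
Lemma artin_schreier_root (c : k) : c ^+ p - c = 0 -> exists n : nat, c = n%:R.
Proof.
rewrite -(rising_pchar (c : k^o) char_k) => /eqP; rewrite prodf_seq_eq0.
case/hasP=> i _; rewrite addr_eq0 => /eqP cE; exists (p - i)%N.
by rewrite natrB ?(ltnW (ltn_ord i)) // (pcharf0 char_k) sub0r.
Qed.
End PowerOfX.

Section Commutation.
Variables (k : fieldType) (p : nat) (H : hopfAlgType k).
Local Notation H0 := (coradical H).
Implicit Types g h : grouplike H.
Hypotheses (char_k : p \in [pchar k]) (pointed_H : pointed H).
Hypothesis rank_one_H : has_rank H 1.
Variables (a : grouplike H) (x : H).
Hypotheses (a1 : a != 1%g) (Dx : skew_primitive a 1%g x) (xNH0 : x \notin H0).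
Hypothesis ax : (a : H) * x * (a : H)^-1 = x + ((a : H) - 1).

Lemma a_sub1_neq0 : (a : H) - 1 != 0.
Proof. by rewrite subr_eq0; apply: contra a1 => /eqP aE; apply/eqP/val_inj. Qed.

Lemma scaler_a_inj (c d : k) : c *: ((a : H) - 1) = d *: ((a : H) - 1) -> c = d.
Proof.
move/eqP; rewrite -subr_eq0 -scalerBl scaler_eq0 (negPf a_sub1_neq0) orbF.
by rewrite subr_eq0 => /eqP.
Qed.

Lemma skew_conj g : skew_primitive (a ^ g^-1)%g 1%g ((g : H) * x * (g : H)^-1).
Proof.
have Dg' : comul (g : H)^-1 = (g : H)^-1 ⊗ (g : H)^-1 := gl_comul (g^-1)%g.
rewrite /skew_primitive !rmorphM /= Dg' gl_comul Dx /= mulrDr mulrDl !pureM.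
by rewrite mulr1 mulrV ?gl_unit // invrK mulrA.
Qed.

Lemma conj_a_sub1 g : commute g a ->
  (g : H) * ((a : H) - 1) * (g : H)^-1 = (a : H) - 1.
Proof.
move/(congr1 val) => /= gaH; rewrite mulrBr mulrBl mulr1 mulrV ?gl_unit // gaH.
by rewrite mulrK ?gl_unit.
Qed.

Lemma conj_translate g (u : H) (c : k) : commute g a ->
  (g : H) * (u + c *: ((a : H) - 1)) * (g : H)^-1
  = (g : H) * u * (g : H)^-1 + c *: ((a : H) - 1).
Proof.
by move=> cga; rewrite mulrDr mulrDl -scalerAr -scalerAl conj_a_sub1.
Qed.

(** Conjugation by g moves x to a skew-primitive element outside H_0, which
    forces g to commute with a and gives l x + c (a - 1) for some l and c.
    Conjugating by a as well, in both orders, gives l = 1. *)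
Lemma conj_x_central g : commute g a /\
  exists c : k, (g : H) * x * (g : H)^-1 = x + c *: ((a : H) - 1).
Proof.
have yNH0 : (g : H) * x * (g : H)^-1 \notin H0.
  apply: contra xNH0.
  move/(coradicalMr pointed_H g)/(coradicalMl pointed_H g^-1%g) => /=.
  by rewrite mulrVK ?gl_unit // glVK.
have x_coinv := skew_left_coinvariant Dx.
have [aE [l [c yE]]] := skew_primitive_noncoradical pointed_H rank_one_H
   x_coinv xNH0 Dx (skew_conj g) yNH0.
have cga : commute g a.
  by rewrite /commute -{2}aE conjgE invgK -!mulgA mulVg mulg1.
split=> //; exists c.
have gaH : (g : H) * (a : H) = (a : H) * (g : H) := congr1 val cga.
have E : (a : H) * ((g : H) * x * (g : H)^-1) * (a : H)^-1
       = (g : H) * ((a : H) * x * (a : H)^-1) * (g : H)^-1.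
  rewrite !mulrA -gaH -[LHS]mulrA -[RHS]mulrA -!invrM ?gl_unit //.
  by rewrite gaH.
move: E; rewrite ax -[X in x + X]scale1r conj_translate // yE.
rewrite conj_translate // -scalerAr -scalerAl ax scalerDr -!addrA.
by move/addrI; rewrite addrC => /addrI /scaler_a_inj ->; rewrite scale1r.
Qed.

Lemma conj_x_hom : (forall g, commute g a) /\ exists c : grouplike H -> k,
  [/\ forall g, (g : H) * x * (g : H)^-1 = x + c g *: ((a : H) - 1),
      forall g h, c (g * h)%g = c g + c h & c a = 1].
Proof.
split=> [g|]; first by have [] := conj_x_central g.
have /boolp.choice[c cE] g := (conj_x_central g).2.
exists c; split=> // [g h|].
  have E : ((g * h)%g : H) * x * ((g * h)%g : H)^-1
    = (g : H) * ((h : H) * x * (h : H)^-1) * (g : H)^-1.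
    by rewrite /= invrM ?gl_unit // !mulrA.
  apply: scaler_a_inj; apply: (addrI x); rewrite -cE E cE.
  by rewrite (conj_translate _ _ (conj_x_central g).1) cE -addrA -scalerDl.
by apply: scaler_a_inj; rewrite scale1r; apply: (addrI x); rewrite -cE.
Qed.

(** The additive character takes the value n at a ^ n, so the order of a is
    zero in k. *)
Lemma p_dvd_order : (p %| #[a]%g)%N.
Proof.
have [_ [c [_ cM ca]]] := conj_x_hom.
have c1 : c 1%g = 0.
  have := cM 1%g 1%g; rewrite mulg1 => /esym/eqP.
  by rewrite -subr_eq0 addrK => /eqP.
have cX n : c (a ^+ n)%g = n%:R.
  by elim: n => [|n IHn]; rewrite ?expg0 // expgS cM ca IHn mulrS.
by rewrite (dvdn_pcharf char_k) -cX expg_order c1.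
Qed.

(** The element x ^ p - x is skew-primitive for a ^ p and 1.  It lies in H_0,
    since otherwise a ^ p = a and the order of a would divide p - 1, although
    it is a multiple of p. *)
Lemma x_pow : exists al : k, x ^+ p = x + al *: ((a : H) ^+ p - 1).
Proof.
have zP := skew_artin_schreier char_k Dx ax.
have [zH0|zNH0] := boolP (x ^+ p - x \in H0).
  have [al E] := skew_primitive_coradical pointed_H zP zH0.
  by exists al; rewrite -glX -E addrC subrK.
have x_coinv := skew_left_coinvariant Dx.
have [aE _] := skew_primitive_noncoradical pointed_H rank_one_H
   x_coinv xNH0 Dx zP zNH0.
have p_gt0 := prime_gt0 (pcharf_prime char_k).
have p_gt1 := prime_gt1 (pcharf_prime char_k).
have : (#[a]%g %| p.-1)%N.
  by rewrite order_dvdn; apply/eqP/(mulgI a); rewrite -expgS prednK // mulg1.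
move/(dvdn_trans p_dvd_order)/dvdn_leq => le_p.
have : (p <= p.-1)%N by apply: le_p; lia.
by lia.
Qed.

(** Conjugating x ^ p - x = al (a ^ p - 1) by g fixes the right-hand side and
    adds (c ^ p - c) (a ^ p - 1) to the left-hand side. *)
Lemma conj_coef_prime_field (c : k) g :
    (g : H) * x * (g : H)^-1 = x + c *: ((a : H) - 1) ->
  (a ^+ p != 1)%g -> exists n : nat, c = n%:R.
Proof.
move=> gx ap1; apply: (artin_schreier_root char_k).
have [al xp] := x_pow.
have := artin_schreier_translate char_k ax c.
rewrite /= -gx.
have conjX n : ((g : H) * x * (g : H)^-1) ^+ n = (g : H) * x ^+ n * (g : H)^-1.
  elim: n => [|n IHn]; first by rewrite !expr0 mulr1 mulrV ?gl_unit.
  by rewrite !exprS IHn !mulrA mulrVK ?gl_unit.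
rewrite conjX -mulrBl -mulrBr xp [x + _ - x]addrC addKr.
have cga : commute g (a ^+ p)%g by apply: commuteX; have [] := conj_x_central g.
have cgaH : (g : H) * (a : H) ^+ p = (a : H) ^+ p * (g : H).
  by rewrite -glX; apply: (congr1 val cga).
rewrite -scalerAr -scalerAl mulrBr mulr1 cgaH mulrBl mulrK ?mulrV ?gl_unit //.
rewrite -{1}[_ *: _]addr0 => /addrI/esym/eqP; rewrite scaler_eq0.
case/orP=> [/eqP//|].
rewrite subr_eq0 -glX => /eqP apE; by case/eqP: ap1; apply: val_inj.
Qed.
End Commutation.

(** * The antipode and the independence of the monomials *)

Section Antipode.
Variables (k : fieldType) (H : hopfAlgType k).
Implicit Types g h : grouplike H.

Lemma antipode_gl g : antipode (g : H) = (g : H)^-1.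
Proof.
have := antipodel (g : H); rewrite gl_comul gl_counit scale1r.
rewrite (tensor_liftE _ _ (bilin_comp antipode idfun (@bilin_mul k H))) /= => E.
by rewrite -[LHS](mulrK (gl_unit g)) E mul1r.
Qed.

(** The hypothesis says that A * id = c counit for the convolution product; by
    associativity A = A * (id * antipode) = (A * id) * antipode. *)
Lemma convolution_antipode (A : {linear H -> H}) (c : H) :
    (forall u,
      tensor_lift (fun u v => A u * v) (comul u) = (counit u : k) *: c) ->
  forall u, A u = c * antipode u.
Proof.
move=> Ac u.
have bA : bilin (fun u v : H => A u * v) := bilin_comp A idfun (@bilin_mul k H).
have bS : bilin (fun u v : H => u * antipode v).
  exact: (bilin_comp idfun antipode (@bilin_mul k H)).
have bC : bilin (fun u v : H => (counit v : k) *: u).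
  have [bl br] := bilin_comp (@counit k H) idfun (@bilin_scale k H).
  by split=> [v|v]; [exact: br | exact: bl].
pose m3 : {linear tensor H (tensor H H) -> H} :=
  tensor_lift (fun (u : H) (t : tensor H H) =>
    A u * tensor_lift (fun u v : H => u * antipode v) t).
have m3E (v : H) (t : tensor H H) : m3 (v ⊗ t) =
    A v * tensor_lift (fun u v : H => u * antipode v) t.
  rewrite /m3 /= tensor_liftE //.
  exact: (bilin_comp A (tensor_lift (fun u v : H => u * antipode v))
    (@bilin_mul k H)).
have := congr1 m3 (comulA u).
have -> : m3 (tensor_map id comul (comul u)) = A u.
  rewrite -[RHS](congr1 A (counitr u)).
  move: (comul u); apply: (@tensor_linear_eq k H H _
    (m3 \o tensor_map idfun comul)
    (A \o tensor_lift (fun u v : H => (counit v : k) *: u))) => v w /=.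
  by rewrite tensor_mapE m3E antipoder tensor_liftE // linearZ /= mulr_algr.
move=> <-.
have m3A (s : tensor H H) (w : H) : m3 (tensor_assoc (s ⊗ w)) =
    tensor_lift (fun u v => A u * v) s * antipode w.
  move: s; apply: (@tensor_linear_eq k H H _
     (m3 \o (@tensor_assoc k H H H \o pure_left w))
     ((antipode w \o* idfun) \o tensor_lift (fun u v => A u * v))) => v v' /=.
  by rewrite /pure_left tensor_assocE m3E !tensor_liftE // mulrA.
rewrite -[RHS](congr1 (fun v => c * antipode v) (slice_counit u)).
move: (comul u); apply: (@tensor_linear_eq k H H _
    (m3 \o (@tensor_assoc k H H H \o tensor_map comul idfun))
    ((c \*o idfun) \o (antipode \o @slice k H H counit))) => v w /=.
rewrite tensor_mapE m3A Ac sliceE linearZ /=.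
by rewrite -scalerAl -scalerAr.
Qed.
End Antipode.

Section Basis.
Variables (k : fieldType) (H : hopfAlgType k).
Local Notation H0 := (coradical H).
Implicit Types g h : grouplike H.
Hypothesis pointed_H : pointed H.
Variables (a : grouplike H) (x : H) (c : grouplike H -> k).
Hypotheses (Dx : skew_primitive a 1%g x) (xNH0 : x \notin H0).
Hypothesis gx : forall g, (g : H) * x * (g : H)^-1 = x + c g *: ((a : H) - 1).
Hypothesis a_central : forall g, commute g a.

Lemma x_gl g :
  x * (g : H) = (g : H) * x - c g *: ((g * a)%g : H) + c g *: (g : H).
Proof.
have /(congr1 (fun u => u * (g : H))) := gx g.
rewrite /= mulrVK ?gl_unit // => ->.
have gaH : (g : H) * (a : H) = (a : H) * (g : H) := congr1 val (a_central g).
rewrite /= gaH mulrDl -scalerAl mulrBl mul1r scalerBr.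
by rewrite addrA [RHS]addrAC subrK addrK.
Qed.

Definition xdeg_lt (n : nat) : {vspace H} :=
  cspan (fun u => exists g i, (i < n)%N /\ u = (g : H) * x ^+ i).
Local Notation V := xdeg_lt.

Lemma mem_xdeg_lt g i n : (i < n)%N -> (g : H) * x ^+ i \in V n.
Proof. by move=> lt_in; apply: mem_cspan; exists g, i. Qed.

Lemma xdeg_lt_sub m n : (m <= n)%N -> (V m <= V n)%VS.
Proof.
move=> le_mn; apply: cspan_sub => _ [g [i [lt_im ->]]].
exact: mem_xdeg_lt (leq_trans lt_im le_mn).
Qed.

Lemma xdeg_lt0 u : u \in V 0 -> u = 0.
Proof.
have s0 : (V 0 <= 0)%VS by apply: cspan_sub => v [g [i []]].
by move/(subvP s0); rewrite memv0 => /eqP.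
Qed.

Lemma xdeg_ltMx n u : u \in V n -> u * x \in V n.+1.
Proof.
apply: (@mem_cspan_linear _ _ _ (x \o* idfun)) => _ [g [i [lt_in ->]]] /=.
by rewrite -mulrA -exprSr mem_xdeg_lt.
Qed.

Lemma gl_pow_gl i g h :
  (g : H) * x ^+ i * (h : H) - ((g * h)%g : H) * x ^+ i \in V i.
Proof.
elim: i h => [|i IHi] h; first by rewrite !expr0 !mulr1 subrr mem0v.
have memi h' : (g : H) * x ^+ i * (h' : H) \in V i.+1.
  rewrite -[X in X \in _](subrK (((g * h')%g : H) * x ^+ i)).
  rewrite memvD ?mem_xdeg_lt //.
  exact: subvP (xdeg_lt_sub (leqnSn i)) _ (IHi h').
have -> : (g : H) * x ^+ i.+1 * (h : H) - ((g * h)%g : H) * x ^+ i.+1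
  = ((g : H) * x ^+ i * (h : H) - ((g * h)%g : H) * x ^+ i) * x
    + (c h *: ((g : H) * x ^+ i * (h : H))
       - c h *: ((g : H) * x ^+ i * ((h * a)%g : H))).
  rewrite exprSr !mulrA -(mulrA _ x) x_gl mulrBl mulrDr mulrBr -!scalerAr.
  rewrite !mulrA.
  by rewrite !addrA [LHS](ACl (1*4*3*2)).
by rewrite memvD ?xdeg_ltMx // memvB ?memvZ.
Qed.

Lemma xdeg_ltMgl n u h : u \in V n -> u * (h : H) \in V n.
Proof.
apply: (@mem_cspan_linear _ _ _ ((h : H) \o* idfun)) => _ [g [i [lt_in ->]]] /=.
rewrite -[X in X \in _](subrK (((g * h)%g : H) * x ^+ i)).
rewrite memvD ?mem_xdeg_lt //.
exact: subvP (xdeg_lt_sub (ltnW lt_in)) _ (gl_pow_gl i g h).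
Qed.

Implicit Types f : {linear H -> k^o}.
(** Right action of the dual algebra on H.  For f vanishing on H_0 it lowers
    the degree in x, like a derivation. *)
Definition hit f : H -> H := @slice k H H f \o comul.

Lemma hit_linear f : linear (hit f).
Proof. by move=> b u v; rewrite /hit /= !linearP. Qed.
HB.instance Definition _ f :=
  GRing.isLinear.Build k H H _ (hit f) (hit_linear f).

Lemma hit_gl f g : hit f (g : H) = (f (g : H) : k) *: (g : H).
Proof. by rewrite /hit /= gl_comul sliceE. Qed.

(** A twisted Leibniz rule, read off the coproduct of x. *)
Lemma hit_mulx f u :
  hit f (u * x) = hit (f \o (x \o* idfun)) u * (a : H) + hit f u * x.
Proof.
rewrite /hit /= rmorphM /= Dx mulrDr linearD /=; congr (_ + _).
  apply: (@tensor_linear_eq k H H _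
    (@slice k H H f \o ((x ⊗ (a : H)) \o* idfun))
    (((a : H) \o* idfun) \o @slice k H H (f \o (x \o* idfun)))) => v w /=.
  by rewrite pureM !sliceE /= -scalerAl.
apply: (@tensor_linear_eq k H H _ (@slice k H H f \o ((1 ⊗ x) \o* idfun))
    ((x \o* idfun) \o @slice k H H f)) => v w /=.
by rewrite pureM mulr1 !sliceE /= -scalerAl.
Qed.

Lemma hit_xdeg f g n : hit f ((g : H) * x ^+ n) \in V n.+1.
Proof.
elim: n f => [|n IHn] f.
  rewrite expr0 mulr1 hit_gl memvZ // -[glval g]mulr1 -(expr0 x).
  exact: mem_xdeg_lt.
rewrite exprSr mulrA hit_mulx memvD ?xdeg_ltMx // xdeg_ltMgl //.
exact: subvP (xdeg_lt_sub (leqnSn _)) _ (IHn _).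
Qed.

Lemma hit_xdeg0 f g n : (forall b, b \in H0 -> f b = 0) ->
  hit f ((g : H) * x ^+ n) \in V n.
Proof.
move=> f0; elim: n => [|n IHn].
  by rewrite expr0 mulr1 hit_gl f0 ?scale0r ?mem0v ?gl_coradical.
by rewrite exprSr mulrA hit_mulx memvD ?xdeg_ltMx // xdeg_ltMgl // hit_xdeg.
Qed.

(** The averaged functional of one that vanishes on H_0 and takes the value 1
    at x. *)
Lemma coradical1_functional :
  exists f, (forall b, b \in H0 -> f b = 0) /\
            forall g, f ((g : H) * x) = 1.
Proof.
have [f [f0 f1]] := separating_functional xNH0.
have x_coinv := skew_left_coinvariant Dx.
exists (avg f); split=> [|g].
  apply: (@coradical_linear_eq k H pointed_H _ (avg f) \0) => g.
  exact: avg_gl.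
rewrite /= avg_glM // ?avg_coinvariant //.
exact: left_coinvariant_coradical1.
Qed.

(** Up to lower degree, hit f acts on x ^ n as differentiation with respect to
    x.  By the Leibniz rule the induction needs the action of u |-> f (u x), which
    agrees with the counit on H_0 and therefore acts as the identity up to
    lower degree. *)
Lemma hit_leading f n g :
    (forall b, b \in H0 -> f b = 0) -> (forall g, f ((g : H) * x) = 1) ->
  hit f ((g : H) * x ^+ n.+1) - n.+1%:R *: (((g * a)%g : H) * x ^+ n) \in V n.
Proof.
move=> f0 f1.
pose f' : {linear H -> k^o} := f \o (x \o* idfun) \- counit.
have f'0 b : b \in H0 -> f' b = 0.
  apply: (@coradical_linear_eq k H pointed_H _ f' \0) => h.
  by rewrite /= f1 gl_counit subrr.
have hf' u : hit (f \o (x \o* idfun)) u = u + hit f' u.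
  rewrite -{2}(slice_counit u).
  apply: (@tensor_linear_eq k H H _ (@slice k H H (f \o (x \o* idfun)))
    (@slice k H H counit \+ @slice k H H f')) => v w /=.
  by rewrite !sliceE /= -scalerDl addrC subrK.
have step m :
    hit f ((g : H) * x ^+ m) * x - m%:R *: (((g * a)%g : H) * x ^+ m) \in V m ->
    hit f ((g : H) * x ^+ m.+1) - m.+1%:R *: (((g * a)%g : H) * x ^+ m) \in V m.
  move=> Hm; rewrite exprSr mulrA hit_mulx hf' mulrDl -natr1 scalerDl scale1r.
  rewrite opprD !addrA [X in X \in _](ACl ((1*5)*2*(3*4))) /=.
  apply: memvD => //; apply: memvD; first exact: gl_pow_gl.
  by apply: xdeg_ltMgl; apply: hit_xdeg0.
apply: (step _); elim: n => [|n /step]; last first.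
  by move/xdeg_ltMx; rewrite mulrBl -scalerAl -mulrA -exprSr.
by rewrite expr0 mulr1 hit_gl f0 ?gl_coradical // !scale0r mul0r subrr mem0v.
Qed.

Variable p : nat.
Hypothesis char_k : p \in [pchar k].

(** Differentiating a relation in degree n + 1 < p gives one in degree n, and
    the factor n + 1 is invertible; degree 0 is the independence of the
    group-likes. *)
Lemma leading_independent n (l : grouplike H -> k) : (n < p)%N ->
  \sum_(g : grouplike H) l g *: ((g : H) * x ^+ n) \in V n -> forall g, l g = 0.
Proof.
elim: n l => [|n IHn] l lt_np.
  move/xdeg_lt0 => l0 g; have := congr1 (gl_dual g) l0.
  rewrite linear0 linear_sum /= (bigD1 g) //= big1 => [|h hg].
    rewrite expr0 mulr1 linearZ /= gl_dualE eqxx addr0 => <-.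
    exact/esym/mulr1.
  by rewrite expr0 mulr1 linearZ /= gl_dualE (negPf hg); apply: mulr0.
have [f [f0 f1]] := coradical1_functional.
pose u := \sum_(g : grouplike H) l g *: ((g : H) * x ^+ n.+1).
move=> lV; have hV : hit f u \in V n.
  move: lV; apply: (@mem_cspan_linear _ _ _ (hit f)) => _ [g [i [lt_in ->]]] /=.
  exact: subvP (xdeg_lt_sub (ltnSE lt_in)) _ (hit_xdeg0 _ _ f0).
(* the leading terms g a x ^ n are reindexed by the group-likes g a *)
pose l' g : k := l (g * a^-1)%g * n.+1%:R.
have l'V : \sum_(g : grouplike H) l' g *: ((g : H) * x ^+ n) \in V n.
  rewrite (reindex_inj (mulIg a)) /= /l'.
  under eq_bigr => g _ do rewrite mulgK.
  rewrite -[X in X \in _](subKr (hit f u)).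
  rewrite memvB // /u linear_sum /= -sumrB memv_suml // => g _.
  by rewrite linearZ /= -scalerA -scalerBr memvZ // hit_leading.
move=> g; have /eqP := IHn _ (ltnW lt_np) l'V (g * a)%g.
rewrite /l' mulgK mulf_eq0 => /orP[/eqP//|].
by rewrite -(dvdn_pcharf char_k) => /dvdn_leq-/(_ isT); rewrite leqNgt lt_np.
Qed.

End Basis.

(** * The monomial basis and the theorem *)

Section AntipodeX.
Variables (k : fieldType) (H : hopfAlgType k).
Variables (a : grouplike H) (x : H).
Hypothesis Dx : skew_primitive a 1%g x.

Lemma antipode_skew : antipode x = - (x * (a : H)^-1).
Proof.
have := antipodel x; rewrite Dx linearD /=.
rewrite !(tensor_liftE _ _ (bilin_comp antipode idfun (@bilin_mul k H))) /=.
rewrite (antipode_gl 1%g) /= invr1 mul1r (skew_counit Dx) scale0r.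
by move/eqP; rewrite addr_eq0 -mulNr => /eqP<-; rewrite mulrK ?gl_unit.
Qed.

(** The convolution criterion applied to u |-> antipode (u x): the antipode
    axiom at u x involves only that map and the antipode itself. *)
Lemma antipode_mulx u : antipode (u * x) = antipode x * antipode u.
Proof.
pose A : {linear H -> H} := antipode \o (x \o* idfun).
have bA : bilin (fun u v : H => A u * v) := bilin_comp A idfun (@bilin_mul k H).
have bS : bilin (fun u v : H => antipode u * v).
  exact: (bilin_comp antipode idfun (@bilin_mul k H)).
rewrite -[LHS]/(A u); apply: convolution_antipode => {}u.
have := antipodel (u * x).
rewrite !rmorphM /= (skew_counit Dx) mulr0 scale0r Dx mulrDr linearD /=.
pose L : {linear tensor H H -> H} := tensor_lift (fun u v => antipode u * v).
have -> : tensor_lift (fun u v => antipode u * v) (comul u * (x ⊗ (a : H)))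
   = tensor_lift (fun u v => A u * v) (comul u) * (a : H).
  apply: (@tensor_linear_eq k H H _ (L \o ((x ⊗ (a : H)) \o* idfun))
    (((a : H) \o* idfun) \o tensor_lift (fun u v => A u * v))) => v w /=.
  by rewrite /L /= pureM !tensor_liftE //= mulrA.
have -> : tensor_lift (fun u v => antipode u * v) (comul u * (1 ⊗ x))
   = tensor_lift (fun u v => antipode u * v) (comul u) * x.
  apply: (@tensor_linear_eq k H H _ (L \o ((1 ⊗ x) \o* idfun))
    ((x \o* idfun) \o L)) => v w /=.
  by rewrite /L /= pureM mulr1 !tensor_liftE //= mulrA.
rewrite antipodel => /eqP; rewrite addr_eq0 => /eqP E.
rewrite -[LHS](mulrK (gl_unit a)) E antipode_skew.
by rewrite mulr_algl mulNr -scalerAl scalerN.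
Qed.

Lemma antipode_gl_pow (g : grouplike H) n :
  antipode ((g : H) * x ^+ n) = (- (x * (a : H)^-1)) ^+ n * (g : H)^-1.
Proof.
elim: n => [|n IHn]; first by rewrite !expr0 mulr1 mul1r antipode_gl.
by rewrite exprSr mulrA antipode_mulx IHn antipode_skew mulrA exprS.
Qed.
End AntipodeX.

Section MonomialBasis.
Variables (k : fieldType) (p : nat) (H : hopfAlgType k).
Local Notation H0 := (coradical H).
Implicit Types g h : grouplike H.
Hypotheses (char_k : p \in [pchar k]) (pointed_H : pointed H).
Hypothesis rank_one_H : has_rank H 1.
Hypothesis gen_H : agenv (coradical1 H) = {:H}%VS.
Variables (a : grouplike H) (x : H) (c : grouplike H -> k) (al : k).
Hypotheses (Dx : skew_primitive a 1%g x) (xNH0 : x \notin H0).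
Hypothesis gx : forall g, (g : H) * x * (g : H)^-1 = x + c g *: ((a : H) - 1).
Hypothesis a_central : forall g, commute g a.
Hypothesis xp : x ^+ p = x + al *: ((a : H) ^+ p - 1).
Local Notation V := (xdeg_lt x).

Let p_gt1 : (1 < p)%N := prime_gt1 (pcharf_prime char_k).
Let p_gt0 : (0 < p)%N := prime_gt0 (pcharf_prime char_k).

Lemma gl_xdeg_lt g : (g : H) \in V p.
Proof. by rewrite -[glval g]mulr1 -(expr0 x) mem_xdeg_lt. Qed.

Lemma xdeg_ltp_Mx u : u \in V p -> u * x \in V p.
Proof.
apply: (@mem_cspan_linear _ _ _ (x \o* idfun)) => _ [g [i [lt_ip ->]]] /=.
rewrite -mulrA -exprSr; move: lt_ip; rewrite leq_eqVlt.
case/orP=> [/eqP->|]; last exact: mem_xdeg_lt.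
rewrite xp mulrDr -scalerAr mulrBr mulr1 memvD ?memvZ // ?memvB ?gl_xdeg_lt //.
  by rewrite -{1}[x]expr1 mem_xdeg_lt.
by rewrite -glX; apply: (gl_xdeg_lt (g * a ^+ p)%g).
Qed.

(** The span of the g x ^ i with i < p contains 1 and is stable under right
    multiplication by H_1, which generates H. *)
Lemma xdeg_ltp_full : V p = {:H}%VS.
Proof.
apply/eqP; rewrite eqEsubv subvf -gen_H; apply: agenv_sub_modr.
  by rewrite -memvE; apply: (gl_xdeg_lt 1%g).
apply/prodvP => u v uV vH1.
have := subvP (coradical1_span pointed_H rank_one_H
  (skew_left_coinvariant Dx) xNH0) v vH1.
apply: (@mem_cspan_linear _ _ _ (u \*o idfun)) => _ [g [->|->]] /=.
  exact: (xdeg_ltMgl gx a_central).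
by rewrite mulrA xdeg_ltp_Mx // (xdeg_ltMgl gx a_central).
Qed.

(** Peel off the top power of x; its coefficients vanish by
    leading_independent. *)
Lemma monomials_independent m (l : grouplike H -> nat -> k) : (m <= p)%N ->
    \sum_(g : grouplike H) \sum_(i < m) l g i *: ((g : H) * x ^+ i) = 0 ->
  forall g i, (i < m)%N -> l g i = 0.
Proof.
elim: m => [//|m IHm] lt_mp.
under eq_bigr => g _ do rewrite big_ord_recr /=.
rewrite big_split /= => /eqP; rewrite addr_eq0 => /eqP E.
have lm0 : forall g, l g m = 0.
  apply: (leading_independent pointed_H Dx xNH0 gx a_central char_k lt_mp).
  rewrite -[X in X \in _]opprK -E memvN.
  by do 2!apply: memv_suml => ? _; rewrite memvZ // mem_xdeg_lt.
move=> g i; rewrite ltnS leq_eqVlt => /orP[/eqP->//|lt_im].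
apply: IHm => //; first exact: ltnW.
by rewrite E big1 ?oppr0 // => h _; rewrite lm0 scale0r.
Qed.

Lemma monomial_basis :
  basis_of {:H}
    [seq (g : H) * x ^+ val i | g <- enum {: grouplike H}, i <- enum 'I_p].
Proof.
set X := [seq _ | _ <- _, _ <- _].
pose s := [seq (g, i) | g <- enum {: grouplike H}, i <- enum 'I_p].
pose m (gi : grouplike H * 'I_p) := (gi.1 : H) * x ^+ gi.2.
have XE : X = map m s by rewrite /s map_allpairs.
have s_enum gi : gi \in s.
  by case: gi => g i; apply: allpairs_f; rewrite mem_enum.
have s_uniq : uniq s.
  by apply: allpairs_uniq; rewrite ?enum_uniq // => -[? ?] [? ?] _ _ [-> ->].
apply/andP; split.
  rewrite eqEsubv subvf -xdeg_ltp_full.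
  apply: cspan_sub => _ [g [i [lt_ip ->]]]; apply: memv_span.
  rewrite XE; apply/mapP.
  by exists (g, Ordinal lt_ip).
rewrite XE; apply/(@freeP _ _ _ (in_tuple (map m s))) => l l0 j.
(* coefficients indexed by positions in s become coefficients indexed by g, i *)
pose l' n : k := oapp l 0 (insub n).
have l'E (i : 'I_(size (map m s))) : l' i = l i by rewrite /l' valK.
pose L g (i : nat) : k := oapp (fun i' => l' (index (g, i') s)) 0 (insub i).
have LE g (i : 'I_p) : L g i = l' (index (g, i) s) by rewrite /L valK.
have sum0 :
    \sum_(g : grouplike H) \sum_(i < p) L g i *: ((g : H) * x ^+ i) = 0.
  rewrite -[RHS]l0 pair_big /=.
  transitivity (\sum_(gi <- s) l' (index gi s) *: m gi).
    under eq_bigr => gi _ do rewrite LE -surjective_pairing.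
    apply: perm_big; apply: uniq_perm; rewrite ?index_enum_uniq // => gi.
    by rewrite s_enum mem_index_enum.
  rewrite (big_nth (1%g, Ordinal p_gt0)) -(size_map m) big_mkord.
  apply: eq_bigr => i _; have lt_is : (i < size s)%N by rewrite -(size_map m).
  by rewrite index_uniq // l'E (nth_map (1%g, Ordinal p_gt0)).
have lt_js : (j < size s)%N by have := ltn_ord j; rewrite {2}size_map.
pose gi := nth (1%g, Ordinal p_gt0) s j.
have := monomials_independent (leqnn p) sum0 gi.1 (ltn_ord gi.2).
by rewrite LE -surjective_pairing index_uniq // l'E.
Qed.
End MonomialBasis.

Lemma hopf_iso_refl (k : fieldType) (H : hopfAlgType k) : hopf_iso H H.
Proof.
exists idfun; split=> //; first by exists idfun.
move=> u /=; rewrite -[LHS]/(idfun (comul u)); apply: tensor_linear_eq => v w.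
by rewrite /= tensor_mapE.
Qed.

Theorem theorem4p15 (k : fieldType) (p : nat) (char_k : p \in [pchar k])
    (H : hopfAlgType k) (pointed_H : pointed H) (rank_one_H : has_rank H 1)
    (gen_H : agenv (coradical1 H) = {:H}%VS)
    (a : grouplike H) (skew_a : skew_point a) (third_a : third_type a) :
  exists E : third_type_tuple k p (grouplike H),
    tt_a E = a /\
    exists (HE : hopfAlgType k) (j : grouplike H -> HE) (x : HE),
      is_HE E j x /\ hopf_iso H HE.
Proof.
case: third_a => a1 [x [Dx xNH0 ax]].
have [a_central [c [gx cM ca]]] :=
  conj_x_hom pointed_H rank_one_H a1 Dx xNH0 ax.
have [al xp] := x_pow char_k pointed_H rank_one_H a1 Dx xNH0 ax.
have a_Z : (a \in 'Z([set: grouplike H]))%g.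
  by apply/centerP; split=> [|g _]; [rewrite inE | apply/esym/a_central].
have a_Fp : (a ^+ p != 1)%g -> forall g, exists n : nat, c g = n%:R.
  move=> ap1 g.
  by apply: (conj_coef_prime_field char_k pointed_H rank_one_H a1 Dx xNH0 ax
    (gx g)).
exists (ThirdTypeTuple al a_Z
  (p_dvd_order char_k pointed_H rank_one_H a1 Dx xNH0 ax) cM ca a_Fp).
(* H itself is H_E, with the inclusion of its group-like elements *)
split=> //; exists H, (@glval k H), x; split; last exact: hopf_iso_refl.
split=> //=.
- exact: (monomial_basis char_k pointed_H rank_one_H gen_H Dx xNH0 gx
    a_central xp).
- by move=> g i; rewrite rmorphM rmorphXn /= gl_comul Dx.
- move=> g i; rewrite rmorphM rmorphXn /= gl_counit (skew_counit Dx) mul1r.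
  by rewrite expr0n.
by move=> g i; rewrite (antipode_gl_pow Dx).
Qed.
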